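(* If $X$ is an integrable random closed set in $\mathfrak{X}$, then $\mathbf{E}(X|\mathcal{H})=\mathbf{E}^g(X|\mathcal{H})$ a.s.
   Context: $\mathfrak{X}$ is a separable real Banach space with Borel $\sigma$-algebra $\mathcal{B}(\mathfrak{X})$; $(\Omega,\mathcal{F},\mathbf{P})$ is a complete probability space and $\mathcal{H}\subset\mathcal{F}$ is a sub-$\sigma$-algebra. An $\mathcal{H}$-measurable random set is a set-valued function $\omega\mapsto X(\omega)\subset\mathfrak{X}$ whose graph belongs to $\mathcal{H}\otimes\mathcal{B}(\mathfrak{X})$; ''random set'' means $\mathcal{F}$-measurable; it is closed if its values are closed for almost all $\omega$. For a sub-$\sigma$-algebra $\mathcal{G}\subset\mathcal{F}$, $\mathcal{L}^0(X,\mathcal{G})$ is the family of $\mathcal{G}$-measurable random elements $\xi$ with $\xi\in X$ a.s., and $\mathcal{L}^1(X,\mathcal{G})$ is the subfamily of those with integrable norm. $X$ is integrable if $\mathcal{L}^1(X,\mathcal{F})\neq\emptyset$. $\operatorname{cl}_1$ is the closure in $\mathcal{L}^1$ and $\operatorname{cl}_0$ the closure in probability. For an integrable random closed set $X$, $\mathbf{E}(X|\mathcal{H})$ is the $\mathcal{H}$-measurable random closed set such that $\mathcal{L}^1(\mathbf{E}(X|\mathcal{H}),\mathcal{H})=\operatorname{cl}_1\{\mathbf{E}(\xi|\mathcal{H}):\ \xi\in\mathcal{L}^1(X,\mathcal{F})\}$. A random element $\xi\in\mathcal{L}^0(\mathfrak{X},\mathcal{F})$ admits a generalised conditional expectation if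 there is a countable $\mathcal{H}$-measurable partition $\{A_i,i\geq1\}$ of $\Omega$ such that $\xi\mathbf{1}_{A_i}$ is integrable for all $i$; then $\mathbf{E}^g(\xi|\mathcal{H})=\sum_{i}\mathbf{E}(\xi\mathbf{1}_{A_i}|\mathcal{H})\mathbf{1}_{A_i}$. $\mathcal{L}^{1_{\mathcal{H}}}(X,\mathcal{F})$ is the family of selections $\xi\in\mathcal{L}^0(X,\mathcal{F})$ admitting a generalised conditional expectation. If this family is non-empty, $\mathbf{E}^g(X|\mathcal{H})$ is the $\mathcal{H}$-measurable random closed set such that $\mathcal{L}^0(\mathbf{E}^g(X|\mathcal{H}),\mathcal{H})=\operatorname{cl}_0\{\mathbf{E}^g(\xi|\mathcal{H}):\ \xi\in\mathcal{L}^{1_{\mathcal{H}}}(X,\mathcal{F})\}$. Such sets exist and are a.s. unique. *)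

(* Defs.v *)
From HB Require Import structures.
From mathcomp Require Import all_boot all_order all_algebra.
From mathcomp Require Import all_classical all_reals all_analysis.
Set Implicit Arguments.
Unset Strict Implicit.
Unset Printing Implicit Defensive.
Import Order.TTheory GRing.Theory Num.Theory.
Import numFieldNormedType.Exports.
Local Open Scope classical_set_scope.
Local Open Scope ring_scope.

(* Sub-sigma-algebras are sets of sets [G : set (set T)]; the ambient one is
   [d.-measurable].  Random elements and random sets are plain functions, and
   everything that is only unique almost surely (a conditional expectation of a
   random element or of a random set) is a relation satisfied by all of its
   versions. *)

Definition separable (E : topologicalType) : Prop :=
  exists2 S : set E, countable S & dense S.

Definition borelType (E : ptopologicalType) := g_sigma_algebraType (@open E).

Section RandomElements.
Context {R : realType} {E : completeNormedModType R}.
Context {d : measure_display} {T : measurableType d}.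
Variable P : probability T R.
Implicit Types (G H : set (set T)) (X Y : T -> set E) (xi eta : T -> E).

Definition sub_sigma_algebra_of H : Prop :=
  sigma_algebra [set: T] H /\ H `<=` d.-measurable.

Definition random_element G xi : Prop :=
  measurable_fun [set: g_sigma_algebraType G]
    (xi : g_sigma_algebraType G -> borelType E).

Definition integrable_element xi : Prop :=
  P.-integrable [set: T] (fun w => `|xi w|%:E).

Definition random_set G X : Prop :=
  measurable ([set z | X z.1 z.2] : set (g_sigma_algebraType G * borelType E)).

Definition random_closed_set G X : Prop :=
  random_set G X /\ {ae P, forall w, closed (X w)}.

(* L^0(X, G) and L^1(X, G) *)
Definition L0sel X G : set (T -> E) :=
  [set xi | random_element G xi /\ {ae P, forall w, X w (xi w)}].

Definition L1sel X G : set (T -> E) :=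
  [set xi | L0sel X G xi /\ integrable_element xi].

Definition integrable_random_set X : Prop := L1sel X d.-measurable !=set0.

Definition restrict_to (A : set T) xi : T -> E := fun w => \1_A w *: xi w.

(* Bochner integral *)
Definition simple_element xi : Prop :=
  random_element d.-measurable xi /\ finite_set (range xi).

Definition simple_integral xi : E :=
  \sum_(x \in [set: E]) fine (P (xi @^-1` [set x])) *: x.

Definition bochner_integral xi (v : E) : Prop :=
  exists s : nat -> T -> E,
    [/\ forall n, simple_element (s n),
        (\int[P]_w `|xi w - s n w|%:E)%E @[n --> \oo] --> 0%E &
        simple_integral (s n) @[n --> \oo] --> v].

(* [eta] is a version of E(xi | H), for [xi] integrable: eta and xi have the
   same Bochner integral [v] over every A in H. *)
Definition cond_exp H xi eta : Prop :=
  [/\ random_element H eta, integrable_element eta &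
      forall A, H A -> exists2 v,
        bochner_integral (restrict_to A xi) v &
        bochner_integral (restrict_to A eta) v].

(* The blocks may be empty, so that finite partitions are included. *)
Definition integrability_partition H xi (A : nat -> set T) : Prop :=
  [/\ forall i, H (A i), trivIset [set: nat] A, \bigcup_i A i = [set: T] &
      forall i, integrable_element (restrict_to (A i) xi)].

Definition admits_gen_cond_exp H xi : Prop :=
  exists A, integrability_partition H xi A.

(* [eta] is a version of E^g(xi | H) *)
Definition gen_cond_exp H xi eta : Prop :=
  random_element H eta /\
  exists (A : nat -> set T) (zeta : nat -> T -> E),
    [/\ integrability_partition H xi A,
        forall i, cond_exp H (restrict_to (A i) xi) (zeta i) &
        {ae P, forall w,
          \sum_(0 <= i < n) restrict_to (A i) (zeta i) w @[n --> \oo]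
            --> eta w}].

Definition L1Hsel X H : set (T -> E) :=
  [set xi | L0sel X d.-measurable xi /\ admits_gen_cond_exp H xi].

(* Closures of a family of H-measurable random elements, in L^1 and in
   probability.  Functions are not identified almost surely, so the closure is
   taken among H-measurable functions. *)
Definition cl1 H (S : set (T -> E)) : set (T -> E) :=
  [set xi | [/\ random_element H xi, integrable_element xi &
     forall e : R, 0 < e -> exists2 eta, S eta &
       (\int[P]_w `|xi w - eta w|%:E < e%:E)%E]].

(* The sets [set eta | P (|xi - eta| > e) < e] form a base of neighbourhoods
   of xi for convergence in probability. *)
Definition cl0 H (S : set (T -> E)) : set (T -> E) :=
  [set xi | random_element H xi /\
     forall e : R, 0 < e -> exists2 eta, S eta &
       (P [set w | (e < `|xi w - eta w|)%R] < e%:E)%E].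

(* [Y] is a version of E(X | H) *)
Definition cond_exp_set H X Y : Prop :=
  random_closed_set H Y /\
  L1sel Y H = cl1 H [set eta | exists2 xi,
    L1sel X d.-measurable xi & cond_exp H xi eta].

(* [Y] is a version of E^g(X | H) *)
Definition gen_cond_exp_set H X Y : Prop :=
  random_closed_set H Y /\
  L0sel Y H = cl0 H [set eta | exists2 xi,
    L1Hsel X H xi & gen_cond_exp H xi eta].

End RandomElements.

(* Main.v *)
Require Import Defs.
From HB Require Import structures.
From mathcomp Require Import all_boot all_order all_algebra.
From mathcomp Require Import all_classical all_reals all_analysis.
From mathcomp Require Import measurable_realfun lra.
Set Implicit Arguments.
Unset Strict Implicit.
Unset Printing Implicit Defensive.
Import Order.TTheory GRing.Theory Num.Theory.
Import numFieldNormedType.Exports.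
Import HBNNSimple.
Local Open Scope classical_set_scope.
Local Open Scope ring_scope.

(** The statement has two halves: the selections of the two conditional
    expectations are the same up to null events, and a random closed set is
    determined almost surely by its measurable selections.

    Integrable selections of Y are selections of Z.  A conditional expectation of an
    integrable selection of X is also a generalised one, for the partition
    with a single non-trivial block [cond_exp_gen], and by Markov's inequality
    approximation in L^1 implies approximation in probability [cl1_sub_cl0].

    Integrable selections of Z are selections of Y.  Let eta be a generalised
    conditional expectation of a selection xi of X, given on the block A i by
    zeta i.  Fix one integrable selection chi of X with conditional
    expectation c.  Gluing xi on A i with chi off A i gives an integrable
    selection of X, with conditional expectation equal to zeta i on A i and to
    c off A i; so zeta i lies in Y almost surely on A i, and eta lies in Y
    almost surely [gen_cond_exp_selection].  As Y has closed values, this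
    persists under limits in probability [cl0_ae_closed].

    Two facts carry these arguments.

    Bochner-integrable elements have conditional expectations
    [cond_exp_exists].  For indicators this is the Radon-Nikodym theorem on the
    trace of the probability on H.  Linearity handles simple elements, with an
    L^1 bound, and an integrable element is the sum of a series of simple ones
    that converges absolutely in L^1.

    Comparing selections suffices [ae_subset_of_selections].  If the set where
    Y is not included in Z were not negligible, the measurable selection
    theorem [measurable_selection] would give an H-measurable function picking
    a point of Y outside Z on an event of positive probability.  Cutting it to
    where it is bounded and completing it by a fixed integrable selection of Y
    gives an integrable selection of Y that is not one of Z.

    For the selection theorem, the Banach space is the continuous image of the
    space of sequences of integers, and the pullback of a product-measurable
    set is Souslin [souslin_pullback]: a point belongs to it when some sequence
    is an infinite branch of a tree with measurable nodes.  Since an outer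
    measure is continuous along increasing unions, the tree can be pruned to a
    finitely branching one whose projection still has outer measure above a
    positive constant [tree_bounded_branches].  By compactness the projection
    of the pruned tree is measurable, and its leftmost branch is a measurable
    choice of an infinite branch [leftmost_branchP]. *)

(** * Souslin sets over a measurable space *)

Section Souslin.
Context {d : measure_display} {T : measurableType d}.
Local Notation NN := (nat -> nat).

Definition agree (m : nat) (s t : NN) := forall i, (i < m)%N -> s i = t i.

Lemma agree_le m n s t : (m <= n)%N -> agree n s t -> agree m s t.
Proof. by move=> mn st i im; apply: st; exact: leq_trans mn. Qed.

Definition determined2 (m : nat) (F : NN -> NN -> set T) :=
  forall r r' s s', agree m r r' -> agree m s s' -> F r s = F r' s'.

(** The Souslin operation, with the tree of finite prefixes replaced by a
    countable family of conditions, each depending on finitely many terms of the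
    parameter [r] and of the branch [s].  The number of terms may vary with the
    condition, which lets countable unions and intersections be written down
    without re-indexing prefixes. *)
Definition souslin (S : set (T * NN)) := exists D : nat -> NN -> NN -> set T,
  [/\ forall j r s, measurable (D j r s),
      forall j, exists m, determined2 m (D j) &
      forall w r, S (w, r) <-> exists s, forall j, D j r s w].

Lemma souslin_countType (I : countType) (S : set (T * NN))
    (D : I -> NN -> NN -> set T) :
  (forall j r s, measurable (D j r s)) ->
  (forall j, exists m, determined2 m (D j)) ->
  (forall w r, S (w, r) <-> exists s, forall j, D j r s w) ->
  souslin S.
Proof.
move=> mD dD SD.
exists (fun n r s => if unpickle n is Some i then D i r s else setT); split.
- by move=> j r s; case: unpickle.
- by move=> j; case: unpickle => [i|]//; exists 0%N.
- move=> w r; rewrite SD; split=> -[s Ds]; exists s => j.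
    by case: unpickle.
  by have := Ds (pickle j); rewrite pickleK.
Qed.

(** The first term of the new branch selects the set of the union, and the
    conditions of the other sets are switched off. *)
Lemma souslin_bigcup (F : nat -> set (T * NN)) :
  (forall k, souslin (F k)) -> souslin (\bigcup_k F k).
Proof.
move=> /choice[D FD].
apply: (@souslin_countType _ _ (fun kj r s =>
  if s 0%N == kj.1 then D kj.1 kj.2 r (s \o S) else setT)).
- by move=> [k j] r s; case: ifPn => // _; have [+ _ _] := FD k; exact.
- move=> [k j]; have [_ /(_ j)[m mD] _] := FD k; exists m.+1.
  move=> r r' s s' rr ss /=; rewrite (ss 0%N)//; case: ifPn => // _.
  apply: mD; first by apply: agree_le rr.
  by move=> i im /=; rewrite ss.
- move=> w r; split.
    move=> [k _]; have [_ _ FDk] := FD k; move=> /FDk[s Ds].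
    exists (fun i => if i is i'.+1 then s i' else k) => -[k' j] /=.
    by case: ifPn => // /eqP <-.
  move=> [s Ds]; exists (s 0%N) => //.
  have [_ _ FDk] := FD (s 0%N); apply/FDk; exists (s \o S) => j.
  by have := Ds (s 0%N, j); rewrite /= eqxx.
Qed.

(** A sequence of branches is coded as one branch through a bijection between
    pairs of integers and integers. *)
Lemma souslin_bigcap (F : nat -> set (T * NN)) :
  (forall k, souslin (F k)) -> souslin (\bigcap_k F k).
Proof.
move=> /choice[D FD].
apply: (@souslin_countType _ _ (fun kj r s =>
  D kj.1 kj.2 r (fun i => s (pickle (kj.1, i))))).
- by move=> [k j] r s; have [+ _ _] := FD k; exact.
- move=> [k j]; have [_ /(_ j)[m mD] _] := FD k.
  exists (maxn m (\max_(i < m) (pickle (k, nat_of_ord i)).+1)).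
  move=> r r' s s' rr ss /=; apply: mD.
    by apply: agree_le rr; rewrite leq_maxl.
  move=> i im; apply: ss; rewrite leq_max; apply/orP; right.
  exact: (leq_bigmax (Ordinal im)).
- move=> w r; split.
    move=> Fw; have {Fw} : forall k, exists s, forall j, D k j r s w.
      by move=> k; have [_ _ FDk] := FD k; apply/FDk/Fw.
    move=> /choice[s Ds].
    exists (fun n => if unpickle n is Some (k, i) then s k i else 0%N).
    move=> [k j] /=; under [X in D _ _ _ X]funext do rewrite pickleK.
    exact: Ds.
  move=> [s Ds] k _; have [_ _ FDk] := FD k; apply/FDk.
  by exists (fun i => s (pickle (k, i))) => j; have := Ds (k, j).
Qed.

End Souslin.

(** * A continuous surjection from integer sequences *)

Section BaireParametrisation.
Context {R : realType} {E : completeNormedModType R}.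
Local Notation NN := (nat -> nat).

Lemma separable_seq : separable E ->
  exists e : nat -> E, forall x (r : R), 0 < r -> exists n, `|x - e n| < r.
Proof.
move=> [S cS dS].
have [x0 Sx0] : S !=set0.
  by have [x [_ Sx]] := dS setT (ex_intro _ point I) openT; exists x.
have [e eS] : exists e : nat -> E, S `<=` range e.
  move: cS => /pfcard_geP[S0|]; first by rewrite S0 in Sx0.
  move=> [f]; exists f; exact: (@surj _ _ _ _ f).
exists e => x r r0.
have [y [xy Sy]] := dS (ball x r) (ex_intro _ x (ballxx x r0)) (ball_open x r).
have [n _ ny] := eS _ Sy; exists n; rewrite ny.
by move: xy; rewrite -ball_normE.
Qed.

Lemma half_pow_gt0 n : 0 < 2 ^- n :> R.
Proof. by rewrite invr_gt0 exprn_gt0. Qed.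

Lemma half_powS n : 2 ^- n = 2 * 2 ^- n.+1 :> R.
Proof. by rewrite exprS invfM mulrA divff// mul1r. Qed.

Lemma half_small (r : R) : 0 < r ->
  exists N, forall n, (N <= n)%N -> 2 ^- n < r.
Proof.
move=> r0; have /cvgrPdist_lt/(_ _ r0)[N _ rN] :
    (GRing.exp (2^-1 : R)) @ \oo --> (0 : R).
  by apply: cvg_expr; rewrite ger0_norm ?invr_ge0// invf_lt1// ltr1n.
exists N => n Nn; have := rN n Nn.
by rewrite sub0r normrN exprVn ger0_norm// invr_ge0 exprn_ge0.
Qed.

Lemma geometric_cvg (y : nat -> E) :
  (forall n, `|y n.+1 - y n| <= 2 ^- n) ->
  exists2 l, y @ \oo --> l & forall n, `|l - y n| <= 2 * 2 ^- n.
Proof.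
move=> yS.
have yD n k : `|y (n + k)%N - y n| <= 2 * 2 ^- n - 2 * 2 ^- (n + k).
  elim: k => [|k IH]; first by rewrite addn0 !subrr normr0.
  rewrite addnS; have := yS (n + k)%N.
  have := ler_distD (y (n + k)%N) (y (n + k).+1) (y n).
  move: IH; rewrite (half_powS (n + k)); lra.
have yB n k : (n <= k)%N -> `|y k - y n| <= 2 * 2 ^- n.
  move=> nk; rewrite -(subnKC nk); apply: (le_trans (yD _ _)).
  by rewrite gerBl mulr_ge0// invr_ge0 exprn_ge0.
have cy : cvgn y.
  apply/cauchy_cvgP/cauchy_exP => r r0.
  have [N rN] := half_small (divr_gt0 r0 (ltr0n _ 2)).
  exists (y N); exists N => // k Nk.
  rewrite -ball_normE /ball_/= distrC; apply: le_lt_trans (yB _ _ Nk) _.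
  by have := rN _ (leqnn N); rewrite ltr_pdivlMr// mulrC.
exists (limn y) => // n.
have yl : (fun k => `|y k - y n|) @ \oo --> `|limn y - y n|.
  by apply: cvg_norm; apply: cvgB => //; exact: cvg_cst.
rewrite -(cvg_lim _ yl)//; apply: limr_le; first by apply/cvg_ex; eexists; exact: yl.
by exists n => // k; exact: yB.
Qed.

Variable e : nat -> E.
Hypothesis e_dense : forall x (r : R), 0 < r -> exists n, `|x - e n| < r.

(** The next point [e (r n)] is accepted only if it is close to the current
    one.  Rejecting the others makes every integer sequence converge, so that
    the limit map is total; its modulus of continuity is explicit. *)
Fixpoint baire_approx (r : NN) (n : nat) : E :=
  if n is k.+1 then
    if `|e (r n) - baire_approx r k| <= 2 ^- k then e (r n)
    else baire_approx r k
  else e (r 0%N).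

Definition baire_map (r : NN) : E := lim (baire_approx r @ \oo).

Lemma baire_approx_agree n r s :
  agree n.+1 r s -> baire_approx r n = baire_approx s n.
Proof.
elim: n => [|n IH] rs /=; first by rewrite rs.
by rewrite IH ?rs//; exact: agree_le rs.
Qed.

Lemma baire_map_approx r : baire_approx r @ \oo --> baire_map r /\
  forall n, `|baire_map r - baire_approx r n| <= 2 * 2 ^- n.
Proof.
have [] := @geometric_cvg (baire_approx r).
  move=> n /=; case: ifPn => // _.
  by rewrite subrr normr0 invr_ge0 exprn_ge0.
move=> l rl lB; have -> : baire_map r = l by apply: cvg_lim.
by [].
Qed.

(** A sequence of points of the dense family that approaches [x] fast enough
    is never rejected. *)
Lemma baire_map_surj x : exists r, baire_map r = x.
Proof.
have /choice[r rx] : forall n, exists k, `|x - e k| < 2 ^- n / 2.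
  by move=> n; apply: e_dense; rewrite divr_gt0// half_pow_gt0.
exists r.
have ra n : baire_approx r n = e (r n).
  elim: n => [|n IH] //=; rewrite IH ifT//.
  have := rx n; have := rx n.+1; have := ler_distD x (e (r n.+1)) (e (r n)).
  rewrite (distrC (e (r n.+1)) x).
  have := half_pow_gt0 n.+1; rewrite (half_powS n); lra.
have [rf _] := baire_map_approx r.
apply: (cvg_unique _ rf) => //; apply/cvgrPdist_lt => eps eps0.
have [N hN] := half_small eps0; exists N => // k /hN kN.
rewrite ra; apply: lt_trans kN; apply: lt_le_trans (rx k) _.
by rewrite ler_pdivrMr// ler_peMr ?ler1n// invr_ge0 exprn_ge0.
Qed.

End BaireParametrisation.

(** * Product-measurable sets are Souslin *)

Section Pullback.
Context {R : realType} {E : completeNormedModType R}.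
Context {d : measure_display} {T : measurableType d}.
Local Notation NN := (nat -> nat).
Variable e : nat -> E.

Lemma measurable_cst_set (Q : Prop) : measurable [set _ : T | Q].
Proof.
by have [q|q] := pselect Q; [rewrite (_ : [set _ | _] = setT)|
  rewrite (_ : [set _ | _] = set0)] => //; apply/seteqP; split.
Qed.

(** The limit lies in an open set exactly when, at some stage, the closed ball
    known to contain it is included in that set; this is visible on finitely
    many terms.  Both signs are needed, as the class of sets treated below must
    be closed under complements. *)
Lemma souslin_open (U : set E) : open U ->
  souslin [set z : T * NN | U (baire_map e z.2)] /\
  souslin (~` [set z : T * NN | U (baire_map e z.2)]).
Proof.
move=> oU.
(* The limit is within 2 * 2^-n of the n-th approximation. *)
pose inner n (r : NN) := forall x, `|x - baire_approx e r n| <= 2 * 2 ^- n -> U x.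
have inner_agree n r r' : agree n.+1 r r' -> inner n r = inner n r'.
  by move=> rr; rewrite /inner (baire_approx_agree e rr).
have UP r : U (baire_map e r) <-> exists n, inner n r.
  have [rf rB] := baire_map_approx e r; split; last first.
    by move=> [n]; apply.
  move=> Uf; have [eps /= eps0 epsU] :
      exists2 eps : R, 0 < eps & forall x, `|baire_map e r - x| < eps -> U x.
    have /nbhs_ballP[eps /= eps0 epsU] : nbhs (baire_map e r) U.
      exact: open_nbhs_nbhs.
    by exists eps => // x xe; apply: epsU; rewrite -ball_normE.
  have [N /(_ N (leqnn N)) hN] := half_small (divr_gt0 eps0 (ltr0n _ 4)).
  exists N => x xN; apply: epsU.
  have := ler_distD (baire_approx e r N) (baire_map e r) x.
  rewrite (distrC (baire_approx e r N) x); have := rB N; lra.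
split.
- exists (fun j r s => if s 0%N == j then [set w | inner j r] else setT); split.
  + by move=> j r s; case: ifPn => // _; exact: measurable_cst_set.
  + move=> j; exists j.+1 => r r' s s' rr ss; rewrite (ss 0%N)//.
    by case: ifPn => // _; rewrite (inner_agree _ _ _ rr).
  + move=> w r /=; rewrite UP; split.
      by move=> [n rn]; exists (fun=> n) => j /=; case: ifPn => // /eqP <-.
    by move=> [s /(_ (s 0%N))]; rewrite eqxx; exists (s 0%N).
- exists (fun j r s => [set w | ~ inner j r]); split.
  + by move=> j r s; exact: measurable_cst_set.
  + move=> j; exists j.+1 => r r' s s' rr ss.
    by rewrite (inner_agree _ _ _ rr).
  + move=> w r /=; rewrite UP; split.
      by move=> nr; exists (fun=> 0%N) => j jr; apply: nr; exists j.
    by move=> [s nr] [j /nr].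
Qed.

Lemma souslin_fst (A : set T) : measurable A ->
  souslin [set z : T * NN | A z.1].
Proof.
move=> mA; exists (fun _ _ _ => A); split => //.
- by move=> j; exists 0%N.
- by move=> w r; split => [Aw|[_ /(_ 0%N)]//]; exists (fun=> 0%N).
Qed.

(** Souslin sets are not closed under complements, hence the symmetric
    condition. *)
Lemma souslin_sigma_algebra (U : Type) (g : T * NN -> U) :
  sigma_algebra setT
    [set B : set U | souslin (g @^-1` B) /\ souslin (g @^-1` (~` B))].
Proof.
split=> /=.
- rewrite setC0 preimage_set0 preimage_setT; split.
    exact: (@souslin_fst set0 measurable0).
  exact: (@souslin_fst setT measurableT).
- by move=> A [sA sCA]; rewrite setTD setCK.
- move=> A sA; rewrite preimage_bigcup setC_bigcup preimage_bigcap.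
  split; first by apply: souslin_bigcup => k; have [] := sA k.
  by apply: souslin_bigcap => k; have [] := sA k.
Qed.

Lemma souslin_pullback (G : set (T * borelType E)) : measurable G ->
  souslin [set z : T * NN | G (z.1, baire_map e z.2)].
Proof.
pose g (z : T * NN) : T * borelType E := (z.1, baire_map e z.2).
suff: measurable `<=` [set B : set (T * borelType E) |
    souslin (g @^-1` B) /\ souslin (g @^-1` (~` B))].
  by move=> + mG => /(_ _ mG)[].
have [_ _ _ CI] := (sigma_algebraP (fun X _ => @subsetT _ X)).1
  (souslin_sigma_algebra g).
rewrite measurable_prod_measurableType; apply: smallest_sub.
  exact: souslin_sigma_algebra.
move=> _ [A mA [B mB <-]].
rewrite (_ : A `*` B = (fst @^-1` A) `&` (snd @^-1` B)); last first.
  by apply/seteqP; split => -[x y] /= [].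
apply: (CI (fst @^-1` A) (snd @^-1` B)).
- by split; [exact: (souslin_fst mA)|exact: (souslin_fst (measurableC mA))].
- rewrite /=.
  have : (@measurable _ (borelType E)) `<=` [set B : set E |
    souslin ((snd \o g) @^-1` B) /\ souslin ((snd \o g) @^-1` (~` B))].
    apply: smallest_sub; first exact: souslin_sigma_algebra.
    by move=> U oU /=; exact: souslin_open.
  by move=> /(_ _ mB).
Qed.

End Pullback.

(** * Least index of a sequence of events *)

Section Least.

Definition least (Q : nat -> Prop) : nat :=
  xget 0%N [set n | Q n /\ forall m, (m < n)%N -> ~ Q m].

Lemma leastP (Q : nat -> Prop) : (exists n, Q n) ->
  Q (least Q) /\ forall m, (m < least Q)%N -> ~ Q m.
Proof.
move=> [n Qn]; rewrite /least; case: xgetP => [m _ //|no]; exfalso.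
have exn : exists n, `[< Q n >] by exists n; apply/asboolP.
case: (ex_minnP exn) => m /asboolP Qm mmin; apply: (no m); split => // k km Qk.
by have := mmin k (asboolT Qk); rewrite leqNgt km.
Qed.

Lemma least_none (Q : nat -> Prop) : ~ (exists n, Q n) -> least Q = 0%N.
Proof.
by move=> noQ; apply: xgetPN => n [Qn _]; apply: noQ; exists n.
Qed.

Context {d : measure_display} {T : measurableType d}.

(** The event that the least index is [n] only involves the events up to [n],
    except for [n = 0], which is also the value when no index exists. *)
Lemma measurable_least (Q : nat -> set T) n : (forall n, measurable (Q n)) ->
  measurable [set w | least (Q^~ w) = n].
Proof.
move=> mQ.
have -> : [set w | least (Q^~ w) = n] =
    (Q n `&` \bigcap_(m in [set m | (m < n)%N]) ~` Q m) `|`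
    (if n is 0%N then \bigcap_m ~` Q m else set0).
  apply/seteqP; split => w /=.
    have [ex|no] := pselect (exists k, Q k w).
      have [Ql lmin] := @leastP (Q^~ w) ex => ln; left; rewrite -ln.
      by split => // m /= ml; exact: lmin.
    rewrite least_none// => <-; right => m _ Qm.
    by apply: no; exists m.
  case=> [[Qn nmin]|].
    have [|Ql lmin] := @leastP (Q^~ w); first by exists n.
    apply/eqP; rewrite eqn_leq; apply/andP; split; rewrite leqNgt; apply/negP.
      by move=> /lmin.
    by move=> /nmin.
  case: n => // noQ; apply: least_none => -[k Qk].
  exact: (noQ k).
apply: measurableU.
  apply: measurableI => //; apply: bigcap_measurableType => k _; exact: measurableC.
case: n => // ; apply: bigcapT_measurable => k; exact: measurableC.
Qed.

End Least.

(** * Capacitability and leftmost branches *)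

Section Capacity.
Context {R : realType} {d : measure_display} {T : measurableType d}.
Variable P : probability T R.
Local Notation NN := (nat -> nat).

(** The outer measure of [S] exceeds [dl], as the infimum over the measurable
    covers of [S] is attained. *)
Definition outer_gt (dl : \bar R) (S : set T) :=
  forall B, measurable B -> S `<=` B -> (dl < P B)%E.

(** Continuity of outer measure along increasing unions.  If each [F n] were
    covered by [B n] of measure at most [dl], the increasing sets of points that
    are eventually in all the [B m] would cover the union. *)
Lemma outer_gt_bigcup dl (F : nat -> set T) :
  outer_gt dl (\bigcup_n F n) -> (forall n, F n `<=` F n.+1) -> exists n, outer_gt dl (F n).
Proof.
move=> bigF Fnd; apply/not_existsP => nobig.
have /choice[B BF] : forall n, exists B, [/\ measurable B, F n `<=` B & (P B <= dl)%E].
  move=> n; have := nobig n; move=> /existsNP[B /not_implyP[mB /not_implyP[FB]]].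
  by move=> /negP; rewrite -leNgt => PB; exists B.
(* The B m need not increase; the intersections of their tails do. *)
pose C n := \bigcap_(m in [set m | (n <= m)%N]) B m.
have mC n : measurable (C n).
  by apply: bigcap_measurable => [|k _]; [exists n => /=|have [] := BF k].
have mUC : measurable (\bigcup_n C n) by exact: bigcup_measurable.
have ndC : {homo C : n m / (n <= m)%N >-> (n <= m)%O}.
  move=> n m nm; apply/subsetPset => w Cw k /= mk; apply: Cw => /=.
  exact: leq_trans nm mk.
have FUC : \bigcup_n F n `<=` \bigcup_n C n.
  move=> w [n _ Fn]; exists n => // k /= nk; have [_ + _] := BF k; apply.
  rewrite -(subnKC nk); elim: (k - n)%N => [|i IH]; first by rewrite addn0.
  by rewrite addnS; apply: Fnd.
have := bigF _ mUC FUC; rewrite ltNge => /negP; apply.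
have PC := nondecreasing_cvg_mu (mu := P) mC mUC ndC.
rewrite -(cvg_lim _ PC)//; apply: lime_le; first by apply/cvg_ex; eexists; exact: PC.
apply: nearW => n /=; have [mB _ PB] := BF n; apply: le_trans PB.
by apply: le_measure; rewrite ?inE// => w; apply => /=.
Qed.

Lemma not_negligible_outer_gt (S : set T) : ~ P.-negligible S ->
  exists2 r : R, 0 < r & outer_gt r%:E S.
Proof.
move=> nS; apply: contrapT => /forall2NP nobig; apply: nS.
have /choice[B BS] : forall n, exists B,
    [/\ measurable B, S `<=` B & (P B <= (2 ^- n)%:E)%E].
  move=> n; have [|] := nobig (2 ^- n); first by rewrite half_pow_gt0.
  move=> /existsNP[B /not_implyP[mB /not_implyP[FB]]].
  by move=> /negP; rewrite -leNgt => PB; exists B.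
have mB : measurable (\bigcap_n B n).
  by apply: bigcapT_measurable => k; have [] := BS k.
exists (\bigcap_n B n); split => //; last first.
  by move=> w Sw n _; have [_ + _] := BS n; exact.
apply/eqP; rewrite eq_le measure_ge0 andbT leNgt; apply/negP => PB.
have Pf : P (\bigcap_n B n) \is a fin_num by exact: fin_num_measure.
have /half_small[N /(_ N (leqnn N))] : 0 < fine (P (\bigcap_n B n)).
  by rewrite fine_gt0// PB ltey_eq Pf.
rewrite -lte_fin fineK// ltNge => /negP; apply.
have [mBN _ PBN] := BS N; apply: le_trans PBN.
by apply: le_measure; rewrite ?inE// => w; exact.
Qed.

Variable K : nat -> NN -> set T.
Hypothesis mK : forall k s, measurable (K k s).
Hypothesis KA : forall k s t, agree k s t -> K k s = K k t.
Hypothesis Knd : forall k s, K k.+1 s `<=` K k s.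

Lemma tree_le j k s : (j <= k)%N -> K k s `<=` K j s.
Proof.
move=> jk; rewrite -(subnKC jk); elim: (k - j)%N => [|i IH]; first by rewrite addn0.
by rewrite addnS => w /Knd/IH.
Qed.

(** Choquet's argument: the events with a branch whose next term is at most
    [n] increase to the current event as [n] grows, so one bound after the other
    can be imposed without letting the outer measure drop to [dl]. *)
Lemma tree_bounded_branches dl : outer_gt dl [set w | exists s, forall k, K k s w] ->
  exists b : NN, forall k,
    outer_gt dl [set w | exists s, (forall i, (i < k)%N -> (s i <= b i)%N) /\
                      forall k, K k s w].
Proof.
move=> big0.
pose S (l : seq nat) := [set w | exists s : NN,
  (forall i, (i < size l)%N -> (s i <= nth 0%N l i)%N) /\ forall k, K k s w].
have step l : exists n, outer_gt dl (S l) -> outer_gt dl (S (rcons l n)).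
  have [bigl|] := pselect (outer_gt dl (S l)); last by exists 0%N.
  have : outer_gt dl (\bigcup_n S (rcons l n)).
    move=> B mB SB; apply: bigl => // w [s [sl Ks]]; apply: SB.
    exists (s (size l)) => //; exists s; split => // i.
    rewrite size_rcons nth_rcons ltnS leq_eqVlt => /orP[/eqP ->|il].
      by rewrite ltnn eqxx.
    by rewrite il; exact: sl.
  move=> /outer_gt_bigcup[|n Sn]; last by exists n.
  move=> n w [s [sl Ks]]; exists s; split => // i; rewrite size_rcons => il.
  have := sl i; rewrite size_rcons => /(_ il) /leq_trans; apply.
  by rewrite !nth_rcons; case: ifP => // _; case: ifP.
have [next nextP] := choice step.
pose l := fix l k := if k is k'.+1 then rcons (l k') (next (l k')) else [::].
have lS k : l k.+1 = rcons (l k) (next (l k)) by [].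
have sl k : size (l k) = k by elim: k => //= k IH; rewrite size_rcons IH.
have bigl k : outer_gt dl (S (l k)).
  elim: k => [|k IH] /=; last exact: nextP.
  by move=> B mB SB; apply: big0 => // w [s Ks]; apply: SB; exists s.
exists (fun i => nth 0%N (l i.+1) i) => k B mB SB.
apply: (bigl k) => // w [s [sb Ks]]; apply: SB; exists s; split => // i ik.
have -> : nth 0%N (l i.+1) i = nth 0%N (l k) i.
  rewrite -(subnKC ik); elim: (k - i.+1)%N => [|j IH]; first by rewrite addn0.
  by rewrite addnS IH lS nth_rcons sl ltn_addr//.
by apply: sb; rewrite sl.
Qed.

Lemma measurable_seq_ex (Q : seq nat -> set T) : (forall l, measurable (Q l)) ->
  measurable [set w | exists l, Q l w].
Proof.
move=> mQ; rewrite (_ : [set w | _] = \bigcup_l Q l).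
  by apply: countable_bigcupT_measurable => //; exact: countableP.
by apply/seteqP; split => w [l]; exists l.
Qed.

Lemma nth_mkseq_agree k (s : NN) : agree k (nth 0%N (mkseq s k)) s.
Proof. by move=> i ik; rewrite nth_mkseq. Qed.

Variable b : NN.

(** The finite sequence [l] has, at each level [k], a prolongation that
    respects the bounds [b] and is still in the tree. *)
Definition extendable (l : seq nat) := [set w | forall k, exists s : NN,
  [/\ agree (size l) s (nth 0%N l), forall i, (i < k)%N -> (s i <= b i)%N & K k s w]].

(** The level-[k] condition only depends on a finite prefix, so the quantifier
    over branches ranges over a countable set. *)
Lemma measurable_extendable l : measurable (extendable l).
Proof.
rewrite (_ : extendable l = \bigcap_k [set w | exists t : seq nat,
  ([set _ | agree (size l) (nth 0%N t) (nth 0%N l) /\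
    forall i, (i < k)%N -> (nth 0%N t i <= b i)%N] `&` K k (nth 0%N t)) w]).
  apply: bigcapT_measurable => k; apply: measurable_seq_ex => t.
  by apply: measurableI => //; exact: measurable_cst_set.
apply/seteqP; split => w ext k; last first.
  by have [//|t [[tl tb] Kt]] := ext k; exists (nth 0%N t).
move=> _; have [s [sl sb Ks]] := ext k; exists (mkseq s (maxn k (size l))).
have agr := @nth_mkseq_agree (maxn k (size l)) s.
split; [split|].
- by move=> i il; rewrite agr ?sl// leq_max il orbT.
- by move=> i ik; rewrite agr ?sb// leq_max ik.
- rewrite (KA (t := s))//; apply: agree_le agr; exact: leq_maxl.
Qed.

(** Koenig's lemma: if each of the finitely many admissible next terms failed
    at some level, a prolongation up to the largest of these levels would be
    impossible. *)
Lemma extendable_step l w : extendable l w -> exists n, extendable (rcons l n) w.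
Proof.
move=> ext; apply/not_existsP => no.
have /choice[k kP] : forall n, exists k, forall s : NN,
  ~ [/\ agree (size (rcons l n)) s (nth 0%N (rcons l n)),
      forall i, (i < k)%N -> (s i <= b i)%N & K k s w].
  by move=> n; have /existsNP[k /forallNP] := no n; exists k.
(* The level must also exceed the size of l, for the bound b to apply to the
   next term. *)
pose m := maxn (size l).+1 (\max_(i < (b (size l)).+1) k i).
have [s [sl sb Ks]] := ext m.
have sb0 : (s (size l) <= b (size l))%N by apply: sb; rewrite leq_max leqnn.
have km : (k (s (size l)) <= m)%N.
  rewrite leq_max; apply/orP; right.
  by rewrite -ltnS in sb0; exact: (leq_bigmax (Ordinal sb0)).
apply: (kP (s (size l)) s); split.
- move=> i; rewrite size_rcons nth_rcons ltnS leq_eqVlt => /orP[/eqP ->|il].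
    by rewrite ltnn eqxx.
  by rewrite il; exact: sl.
- by move=> i ik; apply: sb; exact: leq_trans km.
- exact: tree_le Ks.
Qed.

Fixpoint leftmost (k : nat) (w : T) : seq nat :=
  if k is k'.+1 then
    rcons (leftmost k' w) (least (fun n => extendable (rcons (leftmost k' w) n) w))
  else [::].

Definition leftmost_branch (w : T) : NN := fun i => nth 0%N (leftmost i.+1 w) i.

Lemma size_leftmost k w : size (leftmost k w) = k.
Proof. by elim: k => //= k IH; rewrite size_rcons IH. Qed.

Lemma leftmostE k w : leftmost k w = mkseq (leftmost_branch w) k.
Proof.
elim: k => // k IH; rewrite mkseqS -IH /leftmost_branch /=; congr rcons.
by rewrite nth_rcons size_leftmost ltnn eqxx.
Qed.

Lemma measurable_leftmost k l : measurable [set w | leftmost k w = l].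
Proof.
elim: k l => [|k IH] l /=; first exact: measurable_cst_set.
case/lastP: l => [|l n].
  rewrite (_ : [set w | _] = set0)//; apply/seteqP; split => w //=.
  by move/(congr1 size); rewrite size_rcons.
rewrite (_ : [set w | _] = [set w | leftmost k w = l] `&`
    [set w | least (fun n => extendable (rcons l n) w) = n]).
  apply: measurableI; first exact: IH.
  by apply: measurable_least => i; exact: measurable_extendable.
apply/seteqP; split => w /=.
  by move=> /rcons_inj[-> ->].
by move=> [-> ->].
Qed.

Lemma leftmost_extendable k w : extendable [::] w -> extendable (leftmost k w) w.
Proof.
move=> e0; elim: k => [|k IH] //=.
by have [] := @leastP (fun n => extendable (rcons (leftmost k w) n) w)
  (extendable_step IH).
Qed.

(** Membership at level [k] depends on the first [k] terms only, where the
    leftmost branch agrees with a sequence in the tree. *)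
Lemma leftmost_branchP w : extendable [::] w -> forall k, K k (leftmost_branch w) w.
Proof.
move=> /leftmost_extendable e0 k; have [s [sl _ Ks]] := e0 k k.
rewrite (KA (t := s))// => i ik; rewrite sl ?size_leftmost// leftmostE.
by rewrite nth_mkseq.
Qed.

End Capacity.

(** * Borel functions into a separable Banach space *)

Section BorelMeasurability.
Context {R : realType} {E : completeNormedModType R}.
Context {d : measure_display} {T : measurableType d}.

Definition borel_fun (f : T -> E) := measurable_fun setT (f : T -> borelType E).

Lemma borel_funP (f : T -> E) :
  (forall U, open U -> measurable (f @^-1` U)) -> borel_fun f.
Proof.
move=> fU; apply: (@measurability _ _ T (borelType E) setT f (@open E)) => //.
by move=> _ [U oU <-]; rewrite setTI; exact: fU.
Qed.

Lemma borel_fun_open (f : T -> E) U : borel_fun f -> open U ->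
  measurable (f @^-1` U).
Proof.
move=> mf oU; rewrite -[_ @^-1` _]setTI; apply: mf => //.
exact: sub_sigma_algebra.
Qed.

(** A limit lies in the open set [U] exactly when the terms eventually stay at
    a fixed distance from the complement of [U], which is a closed condition on
    each term. *)
Lemma borel_fun_lim (f_ : nat -> T -> E) (f : T -> E) :
  (forall n, borel_fun (f_ n)) -> (forall w, f_ n w @[n --> \oo] --> f w) ->
  borel_fun f.
Proof.
move=> mf ff; apply: borel_funP => U oU.
pose V m := \bigcup_(y in ~` U) ball y (2 ^- m : R).
have oV m : open (V m) by apply: bigcup_open => y _; exact: ball_open.
have -> : f @^-1` U = \bigcup_m \bigcup_N \bigcap_(n in [set n | (N <= n)%N])
    (f_ n @^-1` (~` V m)).
  apply/seteqP; split => w /=.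
    move=> Uf.
    have /nbhs_ballP[r /= r0 rU] : nbhs (f w) U by exact: open_nbhs_nbhs.
    have r20 : 0 < r / 2 by rewrite divr_gt0.
    have [m /(_ m (leqnn m)) hm] := half_small r20.
    have /cvgrPdist_lt/(_ _ r20)[N _ HN] := ff w.
    exists m => //; exists N => // n /= Nn [y Uy] /=.
    rewrite -ball_normE /ball_/= => yf; apply: Uy; apply: rU.
    rewrite -ball_normE /ball_/=.
    have := HN n Nn; have := ler_distD (f_ n w) (f w) y.
    rewrite (distrC (f_ n w) y); lra.
  move=> [m _ [N _ fV]]; apply: contrapT => Uf.
  have m0 : 0 < 2 ^- m :> R by exact: half_pow_gt0.
  have /cvgrPdist_lt/(_ _ m0)[N' _ HN] := ff w.
  apply: (fV (maxn N N') (leq_maxl _ _)); exists (f w) => //.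
  rewrite -ball_normE /ball_/=; apply: HN; exact: leq_maxr.
apply: bigcupT_measurable => m; apply: bigcupT_measurable => N.
apply: bigcap_measurableType => n _; rewrite preimage_setC.
by apply: measurableC; exact: (borel_fun_open (mf n) (oV m)).
Qed.

Lemma borel_fun_cst x : borel_fun (fun=> x).
Proof. by apply: borel_funP => U _; exact: measurable_cst_set. Qed.

Hypothesis sepE : separable E.

(** Separability makes every open subset of [E * E] a countable union of
    products of balls; the Borel sets of the product are thus generated by
    rectangles. *)
Lemma continuous2_measurable (V : topologicalType) (g : E * E -> V)
    (f h : T -> E) (U : set V) : continuous g -> borel_fun f -> borel_fun h ->
  open U -> measurable [set w | U (g (f w, h w))].
Proof.
move=> cg mf mh oU; have [e eE] := separable_seq sepE.
pose box k l n := ball (e k) (2 ^- n : R) `*` ball (e l) (2 ^- n : R).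
rewrite (_ : [set w | _] =
    \bigcup_(i : nat * nat * nat) ([set _ | box i.1.1 i.1.2 i.2 `<=` g @^-1` U] `&`
      (f @^-1` (ball (e i.1.1) (2 ^- i.2 : R)) `&`
       h @^-1` (ball (e i.1.2) (2 ^- i.2 : R))))).
  apply: countable_bigcupT_measurable; first exact: countableP.
  move=> [[k l] n]; apply: measurableI; first exact: measurable_cst_set.
  by apply: measurableI; [apply: (borel_fun_open mf)|apply: (borel_fun_open mh)];
    exact: ball_open.
apply/seteqP; split => w /=; last first.
  by move=> [[[k l] n] _ /= [bU [fk hl]]]; exact: (bU (f w, h w)).
move=> Ug.
have /nbhs_ballP[r /= r0 rU] : nbhs (f w, h w) (g @^-1` U).
  by apply: cg; exact: open_nbhs_nbhs.
have r20 : 0 < r / 2 by rewrite divr_gt0.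
have [n /(_ n (leqnn n)) hn] := half_small r20.
have n0 : 0 < 2 ^- n :> R by exact: half_pow_gt0.
have [k fk] := eE (f w) _ n0; have [l hl] := eE (h w) _ n0.
exists (k, l, n) => //=; rewrite -ball_normE /ball_/= !(distrC (e _)).
split => //; move=> [x y] [/=]; rewrite -ball_normE /ball_/= => kx ly.
apply: rU; split => /=; rewrite -ball_normE /ball_/=.
  by have := ler_distD (e k) (f w) x; lra.
by have := ler_distD (e l) (h w) y; lra.
Qed.

Lemma borel_fun_continuous2 (g : E * E -> E) (f h : T -> E) :
  continuous g -> borel_fun f -> borel_fun h -> borel_fun (fun w => g (f w, h w)).
Proof.
move=> cg mf mh; apply: borel_funP => U oU; exact: (continuous2_measurable cg mf mh oU).
Qed.

Lemma borel_funD (f h : T -> E) :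
  borel_fun f -> borel_fun h -> borel_fun (fun w => f w + h w).
Proof.
move=> mf mh.
have cg : continuous (fun p : E * E => p.1 + p.2).
  by move=> p; apply: cvgD; [exact: cvg_fst|exact: cvg_snd].
exact: (borel_fun_continuous2 cg mf mh).
Qed.

Lemma borel_funB (f h : T -> E) :
  borel_fun f -> borel_fun h -> borel_fun (fun w => f w - h w).
Proof.
move=> mf mh.
have cg : continuous (fun p : E * E => p.1 - p.2).
  by move=> p; apply: cvgB; [exact: cvg_fst|exact: cvg_snd].
exact: (borel_fun_continuous2 cg mf mh).
Qed.

Lemma measurable_norm (f : T -> E) : borel_fun f ->
  measurable_fun setT (fun w => `|f w|).
Proof.
move=> mf; apply: (measurability _ (measurable_realfun.RGenOpens.measurableE R)).
move=> _ [_ [a [b ->] <-]]; rewrite setTI.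
have cn : continuous (fun p : E * E => `|p.1|).
  by move=> p; apply: cvg_norm; exact: cvg_fst.
by apply: (continuous2_measurable cn mf (borel_fun_cst 0)) => //; exact: interval_open.
Qed.

End BorelMeasurability.

(** * Measurable selection *)

Section Selection.
Context {R : realType} {E : completeNormedModType R}.
Context {d : measure_display} {T : measurableType d}.
Variable P : probability T R.

(** The projection of [G] need not be an event; [A] is the projection of a
    finitely branching tree inside it, which is one. *)
Theorem measurable_selection (G : set (T * borelType E)) :
  separable E -> measurable G -> ~ P.-negligible [set w | exists x, G (w, x)] ->
  exists A (f : T -> E),
    [/\ measurable A, (0 < P A)%E, borel_fun f & forall w, A w -> G (w, f w)].
Proof.
move=> sepE mG; have [e eE] := separable_seq sepE.
have [D [mD dD GD]] := souslin_pullback e mG.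
move: dD => /choice[m mDet] nG.
(* The parameter of the point of E and the Souslin branch are interleaved in one
   sequence t; K k keeps the conditions that are decided by its first k terms. *)
pose ev (t : nat -> nat) i := t i.*2; pose od (t : nat -> nat) i := t i.*2.+1.
pose K k t := \bigcap_(j in [set j | (j <= k)%N /\ ((m j).*2 <= k)%N]) D j (ev t) (od t).
have mK k t : measurable (K k t) by apply: bigcap_measurableType => j _.
have KA k s t : agree k s t -> K k s = K k t.
  move=> st; apply: eq_bigcapr => j /= [jk mk]; apply: mDet => i im.
    by apply: st; apply: leq_trans mk; rewrite ltn_double.
  by apply: st; apply: leq_trans mk; rewrite ltn_Sdouble.
have Knd k s : K k.+1 s `<=` K k s.
  by move=> w Kw j /= [jk mk]; apply: Kw; split; exact: leqW.
have KD t w : (forall k, K k t w) <-> forall j, D j (ev t) (od t) w.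
  split => [Kw j|Dw k j _]; last exact: Dw.
  by apply: (Kw (maxn j (m j).*2)); split; rewrite ?leq_maxl ?leq_maxr.
have GK : [set w | exists x, G (w, x)] `<=` [set w | exists t, forall k, K k t w].
  move=> w [x Gx]; have [r rx] := baire_map_surj eE x.
  have [s sD] : exists s, forall j, D j r s w by apply/GD; rewrite /= rx.
  exists (fun i => if odd i then s i./2 else r i./2); apply/KD => j.
  have -> : ev (fun i => if odd i then s i./2 else r i./2) = r.
    by apply/funext => i; rewrite /ev odd_double doubleK.
  have -> // : od (fun i => if odd i then s i./2 else r i./2) = s.
  by apply/funext => i; rewrite /od oddS odd_double -[_.+1./2]/(uphalf _) uphalf_double.
have [dl dl0 bigdl] : exists2 r : R, 0 < r &
    outer_gt P r%:E [set w | exists t, forall k, K k t w].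
  apply: not_negligible_outer_gt => nK; apply: nG; exact: negligibleS nK.
have [b bigb] := tree_bounded_branches bigdl.
pose B k := [set w | exists l : seq nat,
  ([set _ | forall i, (i < k)%N -> (nth 0%N l i <= b i)%N] `&` K k (nth 0%N l)) w].
have mB k : measurable (B k).
  by apply: measurable_seq_ex => l; apply: measurableI => //; exact: measurable_cst_set.
have Bs k (s : nat -> nat) w : (forall i, (i < k)%N -> (s i <= b i)%N) ->
    K k s w -> B k w.
  move=> sb Ks; exists (mkseq s k); split => /=.
    by move=> i ik; rewrite nth_mkseq// sb.
  by rewrite (KA k _ s)//; exact: nth_mkseq_agree.
pose A := \bigcap_k B k.
have mA : measurable A by exact: bigcapT_measurable.
have ndB : {homo B : n p / (n <= p)%N >-> (p <= n)%O}.
  move=> n p np; apply/subsetPset => w [l [lb Kl]]; apply: (Bs n (nth 0%N l)).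
    by move=> i /leq_trans /(_ np); exact: lb.
  exact: (tree_le Knd np Kl).
have PA : (dl%:E <= P A)%E.
  have PB0 : (P (B 0%N) < +oo)%E by rewrite ltey_eq fin_num_measure.
  have PB := nonincreasing_cvg_mu (mu := P) PB0 mB mA ndB.
  rewrite -(cvg_lim _ PB)//; apply: lime_ge; first by apply/cvg_ex; eexists; exact: PB.
  apply: nearW => k /=; apply/ltW/(bigb k) => // w [s [sb Ks]].
  exact: (Bs _ _ _ sb).
pose br := leftmost_branch K b.
exists A, (fun w => baire_map e (ev (br w))); split => //.
- by apply: lt_le_trans PA; rewrite lte_fin.
- apply: (@borel_fun_lim _ _ _ _ (fun n w => baire_approx e (ev (br w)) n)).
    move=> n; apply: borel_funP => U _.
    rewrite (_ : _ @^-1` _ = [set w | exists l, ([set w | leftmost K b n.+1.*2 w = l] `&`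
      [set _ | U (baire_approx e (ev (nth 0%N l)) n)]) w]).
      apply: measurable_seq_ex => l; apply: measurableI; last exact: measurable_cst_set.
      exact: measurable_leftmost.
    have apx w : baire_approx e (ev (br w)) n =
        baire_approx e (ev (nth 0%N (leftmost K b n.+1.*2 w))) n.
      apply: baire_approx_agree => i ik; rewrite /ev leftmostE nth_mkseq//.
      by rewrite ltn_double.
    apply/seteqP; split => w.
      move=> Uw; exists (leftmost K b n.+1.*2 w); split => //.
      by rewrite /mkset -apx.
    by move=> [l [lw]]; rewrite /mkset -lw -apx.
  by move=> w; have [] := baire_map_approx e (ev (br w)).
- move=> w Aw; apply/GD; exists (od (br w)); apply/KD => k.
  apply: (leftmost_branchP KA Knd) => j.
  have [l [lb Kl]] := Aw j I; exists (nth 0%N l); split => //.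
Qed.

End Selection.

(** * Random elements as Borel functions *)

Section RandomElementMeasurability.
Context {R : realType} {E : completeNormedModType R}.
Context {d : measure_display} {T : measurableType d}.

Lemma random_elementP (G : set (set T)) (f : T -> E) : sigma_algebra setT G ->
  random_element G f <-> forall U, open U -> G (f @^-1` U).
Proof.
move=> sG; split => [mf U oU|fG].
  have := borel_fun_open mf oU.
  by rewrite measurable_g_measurableTypeE.
by apply: borel_funP => U oU; apply: sub_sigma_algebra; exact: fG.
Qed.

(** A random element is a Borel function on a copy of [T] that carries a
    generated sigma-algebra; the ambient sigma-algebra generates itself. *)
Lemma random_element_borel (f : T -> E) :
  random_element (@measurable d T) f <-> borel_fun f.
Proof.
split => [|mf].
  move=> /(random_elementP _ (sigma_algebra_measurable T)) mf.
  exact: borel_funP.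
apply/(random_elementP _ (sigma_algebra_measurable T)) => U oU.
exact: borel_fun_open.
Qed.

End RandomElementMeasurability.

(** * Integrals of functions with finite range *)

Section FiniteRange.
Context {R : realType} {d : measure_display} {T : measurableType d}.
Variable P : probability T R.

Lemma finite_range_seq (U : choiceType) (u : T -> U) : finite_set (range u) ->
  exists r : seq U, uniq r /\ forall w, u w \in r.
Proof.
move=> fu; exists (finmap.enum_fset (fset_set (range u))); split.
  exact: finmap.fset_uniq.
by move=> w; rewrite in_fset_set// inE; exists w.
Qed.

Section Fixed.
Variables (U : choiceType) (u : T -> U) (r : seq U).
Hypothesis (ur : uniq r) (uinr : forall w, u w \in r).
Hypothesis mu : forall a, measurable (u @^-1` [set a]).
Let p a := fine (P (u @^-1` [set a])).

Let pE a : P (u @^-1` [set a]) = (p a)%:E.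
Proof. by rewrite /p fineK// fin_num_measure. Qed.

Lemma integral_finite_range (g : U -> R) : (forall a, 0 <= g a) ->
  (\int[P]_w (g (u w))%:E = (\sum_(a <- r) p a * g a)%:E)%E.
Proof.
move=> g0.
under eq_integral => w _.
  have -> : (g (u w))%:E = (\sum_(a <- r) (g a)%:E * (\1_(u @^-1` [set a]) w)%:E)%E.
    under eq_bigr do rewrite -EFinM.
    rewrite sumEFin; congr EFin.
    rewrite (bigD1_seq (u w))//= indicE mem_set//= mulr1 big1 ?addr0// => a au.
    rewrite indicE memNset ?mulr0// => /= ua.
    by rewrite ua eqxx in au.
  over.
have mg a : measurable_fun setT
    ((fun w => (g a)%:E * (\1_(u @^-1` [set a]) w)%:E)%E : T -> \bar R).
  by apply: measurable_funeM; apply/measurable_EFinP; exact: measurable_indic.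
rewrite ge0_integral_sum//; last first.
  by move=> a w _; rewrite mule_ge0// lee_fin.
rewrite -sumEFin; apply: eq_bigr => a _.
rewrite ge0_integralZl_EFin//; last by apply/measurable_EFinP; exact: measurable_indic.
by rewrite integral_indic// setIT -[X in (_ * X)%E]/(P (u @^-1` [set a])) pE -EFinM mulrC.
Qed.

(** Change of variables.  Applied to pairs of simple elements, it reduces the
    additivity of [simple_integral] to the additivity of a finite sum. *)
Lemma simple_integral_comp (E : completeNormedModType R) (F : U -> E) :
  simple_integral P (F \o u) = \sum_(a <- r) p a *: F a.
Proof.
(* Distinct values of u may have the same image under F. *)
pose r' := undup (map F r).
have FuE x : P ((F \o u) @^-1` [set x]) = (\sum_(a <- r | F a == x) p a)%:E.
  have -> : (F \o u) @^-1` [set x] =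
      \bigcup_(a in [set` [seq a <- r | F a == x]]) (u @^-1` [set a]).
    apply/seteqP; split => w /=.
      by move=> Fx; exists (u w) => //=; rewrite mem_filter Fx eqxx uinr.
    by move=> [a /=]; rewrite mem_filter => /andP[/eqP <- _] ->.
  rewrite measure_fin_bigcup//.
  - rewrite -fsbig_seq ?filter_uniq// big_filter -sumEFin.
    by apply: eq_bigr => a _; exact: pE.
  - by move=> a b _ _ [w /= [<- <-]].
rewrite /simple_integral -(@fsbig_widen _ _ _ _ [set` r'])//; last first.
  move=> x [_ /= xr]; rewrite /= FuE /= big_seq_cond big_pred0 ?scale0r// => a.
  apply/negP => /andP[ar /eqP Fa]; apply: xr.
  by rewrite /r' mem_undup; apply/mapP; exists a.
rewrite -fsbig_seq ?undup_uniq//.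
under eq_bigr => x _.
  rewrite FuE /= scaler_suml.
  have -> : \sum_(i <- r | F i == x) p i *: x =
      \sum_(i <- r | F i == x) p i *: F i by apply: eq_bigr => i /eqP ->.
  over.
rewrite (exchange_big_dep predT)//= big_seq [RHS]big_seq.
apply: eq_bigr => a ar; rewrite -big_filter.
rewrite (eq_filter (a2 := pred1 (F a))); last by move=> x; rewrite /= eq_sym.
by rewrite filter_pred1_uniq ?undup_uniq ?big_seq1// mem_undup map_f.
Qed.

End Fixed.

Context {E : completeNormedModType R}.
Local Notation simple := (@simple_element R E d T).
Implicit Types (s t : T -> E).

Lemma simple_fiber s x : simple s -> measurable (s @^-1` [set x]).
Proof.
move=> [/random_element_borel ms _].
rewrite -[X in measurable X]setCK preimage_setC; apply: measurableC.
apply: (borel_fun_open ms); apply: closed_openC.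
exact/accessible_closed_set1/hausdorff_accessible/norm_hausdorff.
Qed.

Lemma simple_pair s t : simple s -> simple t ->
  exists r : seq (E * E), [/\ uniq r, forall w, (s w, t w) \in r &
    forall a, measurable ((fun w => (s w, t w)) @^-1` [set a])].
Proof.
move=> ss st.
have [|r [ur rP]] := @finite_range_seq _ (fun w => (s w, t w)).
  apply: (@sub_finite_set _ _ (range s `*` range t)).
    by move=> _ [w _ <-]; split => /=; exists w.
  by apply: finite_setX; [case: ss|case: st].
exists r; split => // -[x y].
rewrite (_ : _ @^-1` _ = s @^-1` [set x] `&` t @^-1` [set y]).
  by apply: measurableI; exact: simple_fiber.
by apply/seteqP; split => w /= [-> ->].
Qed.

Lemma simple_comp2 (g : E -> E -> E) s t : simple s -> simple t ->
  simple (fun w => g (s w) (t w)).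
Proof.
move=> ss st; have [r [ur rP mr]] := simple_pair ss st; split.
  apply/random_element_borel; apply: borel_funP => U _.
  rewrite (_ : _ @^-1` _ = \bigcup_(a in [set` [seq a <- r | `[< U (g a.1 a.2) >]]])
      (fun w => (s w, t w)) @^-1` [set a]).
    exact: fin_bigcup_measurable.
  apply/seteqP; split => w /=.
    move=> Ug; exists (s w, t w) => //=; rewrite mem_filter rP andbT.
    exact/asboolP.
  by move=> [[x y]/=]; rewrite mem_filter => /andP[/asboolP + _] [-> ->].
apply: (@sub_finite_set _ _ [set` [seq g a.1 a.2 | a <- r]]) => //.
by move=> _ [w _ <-] /=; apply/mapP; exists (s w, t w).
Qed.

Lemma simple_integralD s t : simple s -> simple t ->
  simple_integral P (fun w => s w + t w) = simple_integral P s + simple_integral P t.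
Proof.
move=> ss st; have [r [ur rP mr]] := simple_pair ss st.
rewrite (simple_integral_comp ur rP mr (fun a => a.1 + a.2)).
rewrite (simple_integral_comp ur rP mr fst) (simple_integral_comp ur rP mr snd).
by rewrite -big_split; apply: eq_bigr => a _; rewrite scalerDr.
Qed.

Lemma simple_integralB s t : simple s -> simple t ->
  simple_integral P (fun w => s w - t w) = simple_integral P s - simple_integral P t.
Proof.
move=> ss st; have [r [ur rP mr]] := simple_pair ss st.
rewrite (simple_integral_comp ur rP mr (fun a => a.1 - a.2)).
rewrite (simple_integral_comp ur rP mr fst) (simple_integral_comp ur rP mr snd).
by rewrite -sumrB; apply: eq_bigr => a _; rewrite scalerBr.
Qed.

Lemma le_norm_simple_integral s : simple s ->
  ((`|simple_integral P s|)%:E <= \int[P]_w `|s w|%:E)%E.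
Proof.
move=> ss; have [r [ur rP]] := finite_range_seq ss.2.
have mr a : measurable (s @^-1` [set a]) by exact: simple_fiber.
rewrite (simple_integral_comp ur rP mr id).
rewrite (integral_finite_range ur rP mr (fun a => normr_ge0 a)) lee_fin.
apply: le_trans (ler_norm_sum _ _ _) _; apply: ler_sum => a _.
by rewrite normrZ ger0_norm// fine_ge0.
Qed.

Lemma simple_cst x : simple (fun=> x).
Proof.
split; first by apply/random_element_borel; exact: borel_fun_cst.
by apply: (@sub_finite_set _ _ [set x]) => // _ [w _ <-].
Qed.

End FiniteRange.

(** * The Bochner integral *)

Lemma cvge0P (R : realType) (u : nat -> \bar R) : (forall n, 0 <= u n)%E ->
  u @ \oo --> 0%E <->
  forall e : R, 0 < e -> exists N, forall n, (N <= n)%N -> (u n <= e%:E)%E.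
Proof.
move=> u0; split => [uc e e0|uc].
  have [N _ HN] := uc _ (@nbhs_open_ereal_lt R 0 (fun=> e) e0).
  by exists N => n /HN /ltW.
have uf n e : (u n <= e%:E)%E -> u n \is a fin_num.
  by move=> ue; rewrite ge0_fin_numE//; apply: le_lt_trans ue (ltry _).
apply: cvg_EFin.
  by have [N HN] := uc 1 ltr01; exists N => // n /= /HN /uf.
apply/cvgrPdist_le => e e0; have [N HN] := uc e e0; exists N => // n /= /HN ue.
by rewrite sub0r normrN ger0_norm ?fine_ge0// -lee_fin fineK// (uf _ _ ue).
Qed.

Section Bochner.
Context {R : realType} {E : completeNormedModType R}.
Context {d : measure_display} {T : measurableType d}.
Variable P : probability T R.
Hypothesis sepE : separable E.
Implicit Types (f g h s : T -> E).

Lemma measurable_enorm f : borel_fun f ->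
  measurable_fun setT (fun w => `|f w|%:E).
Proof. by move=> mf; apply/measurable_EFinP; exact: (measurable_norm sepE mf). Qed.

Lemma integral_norm_ge0 f : (0 <= \int[P]_w `|f w|%:E)%E.
Proof. by apply: integral_ge0 => w _; rewrite lee_fin. Qed.

Lemma le_integral_norm f g : borel_fun f -> borel_fun g ->
  (forall w, `|f w| <= `|g w|) ->
  (\int[P]_w `|f w|%:E <= \int[P]_w `|g w|%:E)%E.
Proof.
move=> mf mg fg; apply: ge0_le_integral => //; try exact: measurable_enorm.
by move=> w _; rewrite lee_fin.
Qed.

Lemma le_integral_normD f g : borel_fun f -> borel_fun g ->
  (\int[P]_w `|(f w + g w)%R|%:E <=
   \int[P]_w `|f w|%:E + \int[P]_w `|g w|%:E)%E.
Proof.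
move=> mf mg; rewrite -ge0_integralD//; try exact: measurable_enorm.
apply: ge0_le_integral => //.
- exact/measurable_enorm/borel_funD.
- by apply: emeasurable_funD; exact: measurable_enorm.
- by move=> w _; rewrite -EFinD lee_fin ler_normD.
Qed.

Lemma le_integral_distD f g h : borel_fun f -> borel_fun g -> borel_fun h ->
  (\int[P]_w `|(f w - h w)%R|%:E <=
   \int[P]_w `|(f w - g w)%R|%:E + \int[P]_w `|(g w - h w)%R|%:E)%E.
Proof.
move=> mf mg mh.
apply: le_trans (le_integral_normD (borel_funB sepE mf mg) (borel_funB sepE mg mh)).
by under [leRHS]eq_integral => w _ do rewrite addrA subrK.
Qed.

Lemma integrable_elementP f : borel_fun f ->
  integrable_element P f <-> (\int[P]_w `|f w|%:E < +oo)%E.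
Proof.
move=> mf; split => [/integrableP[_]|fi].
  by under eq_integral do rewrite /= normr_id.
apply/integrableP; split; first exact: measurable_enorm.
by under eq_integral do rewrite /= normr_id.
Qed.

(** The working form of the Bochner integral: one approximating simple element
    for each precision, instead of a sequence. *)
Lemma bochner_integralP h v : bochner_integral P h v <->
  forall e : R, 0 < e -> exists s, [/\ simple_element s,
    (\int[P]_w `|(h w - s w)%R|%:E <= e%:E)%E & `|simple_integral P s - v| <= e].
Proof.
split=> [[s [ss hs sv]] e e0|hv].
  have [N1 H1] := (cvge0P (fun n => integral_norm_ge0 _)).1 hs _ e0.
  have /cvgrPdist_le/(_ _ e0)[N2 _ H2] := sv.
  exists (s (maxn N1 N2)); split => //; first exact: H1 (leq_maxl _ _).
  by rewrite distrC; exact: H2 (leq_maxr _ _).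
have e0 n : 0 < 2 ^- n :> R by exact: half_pow_gt0.
have /choice[s sP] n := hv _ (e0 n).
exists s; split.
- by move=> n; have [] := sP n.
- apply/cvge0P => [n|e e0']; first exact: integral_norm_ge0.
  have [N HN] := half_small e0'; exists N => n /HN Ne.
  by have [_ + _] := sP n; move=> /le_trans; apply; rewrite lee_fin ltW.
- apply/cvgrPdist_lt => eps /half_small[N HN]; exists N => // n /HN.
  by have [_ _ +] := sP n; rewrite distrC; exact: le_lt_trans.
Qed.

Lemma simple_borel s : @simple_element R E d T s -> borel_fun s.
Proof. by move=> [/random_element_borel]. Qed.

Lemma bochner_integral_simple s :
  simple_element s -> bochner_integral P s (simple_integral P s).
Proof.
move=> ss; apply/bochner_integralP => e e0; exists s; split => //.
  under eq_integral do rewrite subrr normr0.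
  by rewrite integral0 lee_fin ltW.
by rewrite subrr normr0 ltW.
Qed.

Lemma bochner_integral_lim h (h_ : nat -> T -> E) (v_ : nat -> E) v :
  borel_fun h -> (forall n, borel_fun (h_ n)) ->
  (forall n, bochner_integral P (h_ n) (v_ n)) ->
  (\int[P]_w `|(h w - h_ n w)%R|%:E)%E @[n --> \oo] --> 0%E ->
  v_ @ \oo --> v -> bochner_integral P h v.
Proof.
move=> mh mh_ hv hh vv; apply/bochner_integralP => e e0.
have e20 : 0 < e / 2 by rewrite divr_gt0.
have [N1 H1] := (cvge0P (fun n => integral_norm_ge0 _)).1 hh _ e20.
have /cvgrPdist_le/(_ _ e20)[N2 _ H2] := vv.
pose n := maxn N1 N2.
have /bochner_integralP/(_ _ e20)[s [ss hs sv]] := hv n.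
exists s; split => //.
  apply: le_trans (le_integral_distD mh (mh_ n) (simple_borel ss)) _.
  rewrite (splitr e) EFinD; apply: leeD => //; exact: H1 (leq_maxl _ _).
have := H2 n (leq_maxr _ _); have := ler_distD (v_ n) (simple_integral P s) v.
rewrite (distrC v (v_ n)); lra.
Qed.

Lemma bochner_integralD f g v1 v2 : borel_fun f -> borel_fun g ->
  bochner_integral P f v1 -> bochner_integral P g v2 ->
  bochner_integral P (fun w => f w + g w) (v1 + v2).
Proof.
move=> mf mg /bochner_integralP fv /bochner_integralP gv.
apply/bochner_integralP => e e0.
have e20 : 0 < e / 2 by rewrite divr_gt0.
have [s [ss fs sv]] := fv _ e20; have [t [st gt tv]] := gv _ e20.
exists (fun w => s w + t w); split; first exact: (simple_comp2 +%R).
  rewrite (splitr e) EFinD; apply: le_trans (leeD fs gt).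
  under eq_integral do rewrite opprD addrACA.
  apply: le_integral_normD; apply: borel_funB => //; exact: simple_borel.
rewrite simple_integralD// opprD addrACA [leRHS]splitr.
by apply: le_trans (ler_normD _ _) _; exact: lerD.
Qed.

Lemma borel_fun_scale (phi : T -> R) (x : E) : measurable_fun setT phi ->
  borel_fun (fun w => phi w *: x).
Proof.
move=> mphi; apply: borel_funP => U oU.
rewrite -[X in measurable X]setTI.
rewrite -[X in _ `&` X]/(phi @^-1` ((fun a : R => a *: x) @^-1` U)).
apply: mphi => //; apply: open_measurable.
by move: U oU; apply/continuousP; exact: scalel_continuous.
Qed.

(** Monotone approximation of [phi] by real simple functions gives simple
    elements with values on the line of [x]. *)
Lemma bochner_integral_scale (phi : T -> R) (x : E) : measurable_fun setT phi ->
  (forall w, 0 <= phi w) -> (\int[P]_w (phi w)%:E < +oo)%E ->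
  bochner_integral P (fun w => phi w *: x) (fine (\int[P]_w (phi w)%:E) *: x).
Proof.
move=> mphi phi0 iphi.
have mf : measurable_fun setT (EFin \o phi) by exact/measurable_EFinP.
have phiI : P.-integrable setT (EFin \o phi).
  apply/integrableP; split => //.
  by under eq_integral => w _ do rewrite gee0_abs ?lee_fin//.
pose g n : T -> R := nnsfun_approx measurableT mf n.
have mg n : measurable_fun setT (g n) by exact: measurable_funPT.
have g0 n w : 0 <= g n w by exact: fun_ge0.
have gphi w : (g n w)%:E @[n --> \oo] --> (phi w)%:E.
  by apply: (@cvg_nnsfun_approx _ _ _ _ measurableT _ mf) => // y _; rewrite lee_fin.
have gle n w : g n w <= phi w.
  rewrite -lee_fin; apply: cvge_ge (gphi w).
  exists n => // m /= nm; rewrite lee_fin.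
  exact: (lefP _ _ (nd_nnsfun_approx measurableT mf nm) w).
have [_ gd gi] : [/\ P.-integrable setT (EFin \o phi),
    (\int[P]_w `|((g n w)%:E - (phi w)%:E)%E|)%E @[n --> \oo] --> 0%E &
    (\int[P]_w (g n w)%:E)%E @[n --> \oo] --> (\int[P]_w (phi w)%:E)%E].
  apply: (@dominated_convergence _ _ _ P setT measurableT
    (fun n => EFin \o g n) (EFin \o phi) (EFin \o phi)) => //.
  - by move=> n; exact/measurable_EFinP.
  - by apply: aeW => w _; exact: gphi.
  - by apply: aeW => w n _ /=; rewrite lee_fin ger0_norm.
have iE n : (\int[P]_w (g n w)%:E)%E = (fine (\int[P]_w (g n w)%:E))%:E.
  rewrite fineK// ge0_fin_numE; last by apply: integral_ge0 => w _; rewrite lee_fin.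
  apply: le_lt_trans iphi; apply: ge0_le_integral => //.
  - by move=> w _; rewrite lee_fin.
  - exact/measurable_EFinP.
  - by move=> w _; rewrite lee_fin.
have ss n : simple_element (fun w => g n w *: x).
  split; first by apply/random_element_borel; exact: borel_fun_scale.
  apply: (@sub_finite_set _ _ ((fun a => a *: x) @` range (g n))).
    by move=> _ [w _ <-]; exists (g n w) => //; exists w.
  by apply: finite_image; exact: fimfunP.
apply: (@bochner_integral_lim _ (fun n w => g n w *: x)
  (fun n => fine (\int[P]_w (g n w)%:E) *: x)).
- exact: borel_fun_scale.
- by move=> n; exact: borel_fun_scale.
- move=> n; have := bochner_integral_simple (ss n); congr bochner_integral.
  have [r [ur rP]] : exists r : seq R, uniq r /\ forall w, g n w \in r.
    by apply: finite_range_seq; exact: fimfunP.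
  have mr a : measurable (g n @^-1` [set a]) by rewrite -[X in measurable X]setTI; exact: mg.
  rewrite (simple_integral_comp P ur rP mr (fun a => a *: x)).
  have := integral_finite_range P ur rP mr (@normr_ge0 _ _).
  under eq_integral => w _ do rewrite ger0_norm//.
  move=> ->; rewrite /= scaler_suml; apply: eq_bigr => a _; rewrite scalerA.
  have [a0|a0] := leP 0 a; first by rewrite ger0_norm.
  rewrite (_ : g n @^-1` [set a] = set0) ?measure0 ?mul0r//.
  by apply/seteqP; split => // w /= ga; move: a0; rewrite -ga ltNge g0.
- have -> : (fun n => \int[P]_w `|phi w *: x - g n w *: x|%:E)%E =
      (fun n => `|x|%:E * \int[P]_w `|((g n w)%:E - (phi w)%:E)%E|)%E.
    apply/funext => n; rewrite -ge0_integralZl_EFin//; last first.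
      apply: measurableT_comp => //; apply: emeasurable_funB => //.
      exact/measurable_EFinP.
    apply: eq_integral => w _.
    by rewrite -scalerBl normrZ EFinM muleC -EFinB /= distrC.
  rewrite -[0%E](mule0 `|x|%:E); exact: cvgeZl.
- apply: cvgZr_tmp; apply: fine_cvg; rewrite fineK//.
  by rewrite ge0_fin_numE// integral_ge0// => w _; rewrite lee_fin.
Qed.

End Bochner.

(** * Conditional probability given a sub-sigma-algebra *)

Section Trace.
Context {R : realType} {d : measure_display} {T : measurableType d}.
Variable P : probability T R.
Variable H : set (set T).
Hypothesis sH : sub_sigma_algebra_of H.
Local Notation TH := (g_sigma_algebraType H).

Lemma sub_measurableE : (@measurable _ TH) = H.
Proof. exact: (@measurable_g_measurableTypeE T H sH.1). Qed.

Lemma measurable_subP (A : set T) : measurable (A : set TH) <-> H A.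
Proof. by rewrite [X in X A]sub_measurableE. Qed.

Lemma sub_measurable (A : set T) : H A -> measurable A.
Proof. by move: A; exact: sH.2. Qed.

Lemma sub_setC (A : set T) : H A -> H (~` A).
Proof. by move=> HA; have [[_ HC _] _] := sH; rewrite -setTD; exact: HC. Qed.

Lemma sub_setT : H setT.
Proof. by rewrite -setC0; apply: sub_setC; have [[]] := sH. Qed.

Lemma measurable_id_sub : measurable_fun setT (id : T -> TH).
Proof.
move=> _ A; rewrite [X in X A -> _]sub_measurableE => HA; rewrite setTI.
exact: sub_measurable.
Qed.

Lemma sub_measurable_fun d' (U : measurableType d') (f : T -> U) :
  measurable_fun setT (f : TH -> U) -> measurable_fun setT f.
Proof. by move=> mf; exact: (measurableT_comp mf measurable_id_sub). Qed.

Lemma sub_borel_fun (E : completeNormedModType R) (f : T -> E) :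
  random_element H f -> borel_fun f.
Proof. exact: sub_measurable_fun. Qed.

(** The two proofs are arguments of the definition so that the measure structures
    below, which depend on them, can be inferred from the term. *)
Definition trace_measure of sub_sigma_algebra_of H := fun (B : set T) of measurable B =>
  fun (A : set TH) => P (A `&` B).

Section Instances.
Variables (B : set T) (mB : measurable B).
Local Notation tr := (trace_measure sH mB).

Let tr0 : tr set0 = 0%E. Proof. by rewrite /trace_measure set0I measure0. Qed.

Let tr_ge0 (A : set _) : (0 <= tr A)%E. Proof. exact: measure_ge0. Qed.

Let tr_sigma_additive : semi_sigma_additive tr.
Proof.
move=> F mF tF mU; rewrite /trace_measure setI_bigcupl; apply: measure_sigma_additive.
  move=> i; apply: measurableI => //; apply: sub_measurable.
  exact/measurable_subP.
apply/trivIsetP => i j _ _ ij.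
move/trivIsetP : tF => /(_ i j I I ij).
by rewrite setIACA => ->; rewrite set0I.
Qed.

HB.instance Definition _ := isMeasure.Build _ _ _ tr tr0 tr_ge0 tr_sigma_additive.

Let tr_fin : fin_num_fun tr.
Proof.
move=> A mA; apply: fin_num_measure; apply: measurableI => //.
exact/sub_measurable/measurable_subP.
Qed.

HB.instance Definition _ := @Measure_isFinite.Build _ _ _ tr tr_fin.

End Instances.

Let tr1 : trace_measure sH measurableT setT = 1%E.
Proof. by rewrite /trace_measure setIT probability_setT. Qed.

HB.instance Definition _ := @Measure_isProbability.Build _ _ _ (trace_measure sH measurableT) tr1.

Definition trim : probability TH R := trace_measure sH measurableT.

Lemma trimE A : trim A = P A.
Proof. by rewrite /trim/= /trace_measure setIT. Qed.

Lemma trim_integral (A : set T) (f : T -> \bar R) : H A ->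
  measurable_fun setT (f : TH -> \bar R) -> (forall w, 0 <= f w)%E ->
  (\int[trim]_(w in A) f w = \int[P]_(w in A) f w)%E.
Proof.
move=> HA mf f0.
have mA : measurable (A : set TH) by exact/measurable_subP.
have /= <- := @ge0_integral_pushforward _ _ T TH R id measurable_id_sub P A f mA
  (measurable_funTS mf) (fun w _ => f0 w).
apply: eq_measure_integral; first exact: measurable_id_sub.
by move=> ? B _ _; exact: trimE.
Qed.

(** [phi] is the Radon-Nikodym derivative, on the sigma-algebra [H], of the
    measure [A |-> P (A `&` B)] with respect to [P]. *)
Lemma cond_prob (B : set T) : measurable B -> exists phi : T -> R,
  [/\ measurable_fun setT (phi : TH -> R), forall w, 0 <= phi w &
    forall A, H A -> (\int[P]_(w in A) (phi w)%:E = P (A `&` B))%E].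
Proof.
move=> mB; pose nu : {finite_measure set TH -> \bar R} := trace_measure sH mB.
have dom : nu `<< trim.
  apply/null_content_dominatesP => A mA; rewrite /nu/= trimE /trace_measure => PA.
  apply/eqP; rewrite eq_le measure_ge0 andbT -PA.
  have mA' : d.-measurable (A : set T) by exact/sub_measurable/measurable_subP.
  by apply: le_measure => //; rewrite inE//; exact: measurableI.
pose f := Radon_Nikodym_SigmaFinite.f nu trim.
have f0 w : (0 <= f w)%E by exact: Radon_Nikodym_SigmaFinite.f_ge0.
have ff w : f w \is a fin_num by exact: Radon_Nikodym_SigmaFinite.f_fin_num.
have mf : measurable_fun setT (f : TH -> \bar R).
  exact: measurable_int (Radon_Nikodym_SigmaFinite.f_integrable dom).
exists (fine \o f); split.
- exact: measurableT_comp.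
- by move=> w; exact: fine_ge0.
- move=> A HA; under eq_integral do rewrite /= fineK//.
  rewrite -trim_integral// -Radon_Nikodym_SigmaFinite.f_integral//.
  exact/measurable_subP.
Qed.

End Trace.

(** * Approximation by simple elements *)

Section Density.
Context {R : realType} {E : completeNormedModType R}.
Context {d : measure_display} {T : measurableType d}.
Variable P : probability T R.
Hypothesis sepE : separable E.
Implicit Types (f g h s : T -> E).

(** Round [f w] to the first point of a dense sequence at distance less than
    [eps / 2], and to zero if that point comes after the [K]-th one.  As [K]
    grows, the truncation disappears by dominated convergence. *)
Lemma simple_approximation f (eps : R) : borel_fun f ->
  (\int[P]_w `|f w|%:E < +oo)%E -> 0 < eps ->
  exists2 s, simple_element s & (\int[P]_w `|(f w - s w)%R|%:E <= eps%:E)%E.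
Proof.
move=> mf fi eps0; have [e eE] := separable_seq sepE.
have e20 : 0 < eps / 2 by rewrite divr_gt0.
pose near k := [set w | `|f w - e k| < eps / 2].
have mnear k : measurable (near k).
  have -> : near k = f @^-1` ball (e k) (eps / 2).
    by apply/seteqP; split => w; rewrite /near/= -ball_normE /ball_/= distrC.
  by apply: borel_fun_open => //; exact: ball_open.
pose kap w := least (near^~ w).
have kapP w : `|f w - e (kap w)| < eps / 2.
  by have [] := @leastP (near^~ w) (eE (f w) _ e20).
have mkap n : measurable [set w | kap w = n] by exact: measurable_least.
pose s K w := if (kap w < K)%N then e (kap w) else 0.
have ss K : simple_element (s K).
  split.
    apply/random_element_borel; apply: borel_funP => U _.
    rewrite (_ : _ @^-1` _ = \bigcup_n ([set w | kap w = n] `&`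
        [set _ | U (if (n < K)%N then e n else 0)])).
      by apply: bigcupT_measurable => n; apply: measurableI => //; exact: measurable_cst_set.
    apply/seteqP; split => w /=; first by move=> Us; exists (kap w).
    by move=> [n _ [<-]].
  apply: (@sub_finite_set _ _ [set` 0 :: [seq e i | i <- iota 0 K]]) => //.
  move=> _ [w _ <-] /=; rewrite /s inE; case: ifPn => [kK|_]; last by rewrite eqxx.
  by apply/orP; right; apply: map_f; rewrite mem_iota.
pose F K w := (`|(f w - s K w)%R|%:E : \bar R).
pose F' w := (`|(f w - e (kap w))%R|%:E : \bar R).
have me : borel_fun (fun w => e (kap w)).
  apply: (@borel_fun_lim _ _ _ _ (fun K w => s K w)).
    by move=> K; exact: (simple_borel (ss K)).
  move=> w; apply/cvgrPdist_le => r r0; exists (kap w).+1 => // K /= kK.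
  by rewrite /s kK subrr normr0 ltW.
have [_ _ Fi] : [/\ P.-integrable setT F',
    (\int[P]_w `|F K w - F' w|)%E @[K --> \oo] --> 0%E &
    (\int[P]_w F K w)%E @[K --> \oo] --> (\int[P]_w F' w)%E].
  apply: (@dominated_convergence _ _ _ P setT measurableT F F'
    (fun w => (`|f w| + eps / 2)%:E)) => //.
  - by move=> K; exact: (measurable_enorm sepE (borel_funB sepE mf (simple_borel (ss K)))).
  - exact: (measurable_enorm sepE (borel_funB sepE mf me)).
  - apply: aeW => w _; apply: cvg_near_cst; exists (kap w).+1 => // K /= kK.
    by rewrite /F /F' /s kK.
  - have -> : (fun w => (`|f w| + eps / 2)%:E) =
        (fun w => `|f w|%:E + (eps / 2)%:E)%E by [].
    apply: integrableD => //.
      exact/integrable_elementP.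
    by apply: finite_measure_integrable_cst.
  - apply: aeW => w K _; rewrite /F gee0_abs ?lee_fin// /s; case: ifPn => _.
      by apply: le_trans (ltW (kapP w)) _; rewrite lerDr.
    by rewrite subr0 lerDl ltW.
have F'e : (\int[P]_w F' w <= (eps / 2)%:E)%E.
  apply: (@le_trans _ _ (\int[P]_w (eps / 2)%:E)%E).
    apply: ge0_le_integral => //.
    - by move=> w _; rewrite lee_fin.
    - exact: (measurable_enorm sepE (borel_funB sepE mf me)).
    - by move=> w _; rewrite lee_fin ltW.
  by rewrite integral_cst// -[X in (_ * X)%E]/(P setT) probability_setT mule1.
suff [K KF] : exists K, (\int[P]_w F K w <= eps%:E)%E by exists (s K).
apply/not_existsP => noK.
have : (eps%:E <= \int[P]_w F' w)%E.
  apply: cvge_ge Fi; apply: nearW => K.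
  by have /negP := noK K; rewrite -ltNge => /ltW.
move=> /le_trans /(_ F'e); rewrite lee_fin leNgt => /negP; apply.
by rewrite ltr_pdivrMr// ltr_pMr// ltr1n.
Qed.

(** The integral is 1-Lipschitz for the L^1 distance.  As it is a relation, this
    also gives the uniqueness of its value. *)
Lemma bochner_integral_dist f g v u : borel_fun f -> borel_fun g ->
  bochner_integral P f v -> bochner_integral P g u ->
  (`|v - u|%:E <= \int[P]_w `|(f w - g w)%R|%:E)%E.
Proof.
move=> mf mg /(bochner_integralP P) fv /(bochner_integralP P) gu.
apply/lee_addgt0Pr => e e0; have e40 : 0 < e / 4 by rewrite divr_gt0.
have [s [ss fs sv]] := fv _ e40; have [t [st gt tu]] := gu _ e40.
have ms := simple_borel ss; have mt := simple_borel st.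
apply: (@le_trans _ _ ((`|simple_integral P s - simple_integral P t|)%:E + (e / 4 + e / 4)%:E)%E).
  rewrite -EFinD lee_fin.
  have := ler_distD (simple_integral P s) v u.
  have := ler_distD (simple_integral P t) (simple_integral P s) u.
  rewrite (distrC v (simple_integral P s)); lra.
rewrite -simple_integralB//.
have st' : simple_element (fun w => s w - t w) by exact: (simple_comp2 (fun x y => x - y)).
apply: (@le_trans _ _ (\int[P]_w `|(s w - t w)%R|%:E + (e / 4 + e / 4)%:E)%E).
  by rewrite leeD2r// le_norm_simple_integral.
apply: (@le_trans _ _ ((e / 4)%:E + (\int[P]_w `|(f w - g w)%R|%:E + (e / 4)%:E) + (e / 4 + e / 4)%:E)%E).
  rewrite leeD2r//; apply: le_trans (le_integral_distD P sepE ms mf mt) _.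
  apply: leeD.
    by under eq_integral do rewrite distrC.
  by apply: le_trans (le_integral_distD P sepE mf mg mt) _; exact: leeD.
rewrite addeCA -addeA leeD2l// -!EFinD lee_fin; lra.
Qed.

End Density.

(** * Restriction to an event *)

Section Restriction.
Context {R : realType} {E : completeNormedModType R}.
Context {d : measure_display} {T : measurableType d}.

Lemma restrict_toE (A : set T) (xi : T -> E) w :
  restrict_to A xi w = if w \in A then xi w else 0.
Proof. by rewrite /restrict_to indicE; case: (w \in A); rewrite ?scale1r ?scale0r. Qed.

Lemma restrict_to_borel (A : set T) (f : T -> E) :
  measurable A -> borel_fun f -> borel_fun (restrict_to A f).
Proof.
move=> mA mf; apply: borel_funP => U oU.
have -> : restrict_to A f @^-1` U =
    (A `&` f @^-1` U) `|` (~` A `&` [set _ | U 0]).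
  apply/seteqP; split => w /=; rewrite restrict_toE.
    by case: ifPn => [/set_mem Aw ?|/negP nA ?]; [left|right; split => // /mem_set].
  by move=> [[Aw fw]|[Aw U0]]; [rewrite mem_set|rewrite memNset].
apply: measurableU; apply: measurableI => //.
- exact: borel_fun_open.
- exact: measurableC.
- exact: measurable_cst_set.
Qed.

End Restriction.

(** * Conditional expectations of simple elements *)

Section CondExp.
Context {R : realType} {E : completeNormedModType R}.
Context {d : measure_display} {T : measurableType d}.
Variable P : probability T R.
Variable H : set (set T).
Hypothesis sepE : separable E.
Hypothesis sH : sub_sigma_algebra_of H.
Local Notation TH := (g_sigma_algebraType H).
Implicit Types (f g h s xi eta : T -> E).

Lemma restrict_to_random_element (A : set T) f : H A ->
  random_element H f -> random_element H (restrict_to A f).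
Proof.
move=> HA mf; apply: (restrict_to_borel (T := TH)) => //.
exact/(measurable_subP sH).
Qed.

Lemma restrict_to_norm (A : set T) f w : `|restrict_to A f w| <= `|f w|.
Proof. by rewrite restrict_toE; case: ifP => // _; rewrite normr0. Qed.

Lemma restrict_toD (A : set T) f g :
  restrict_to A (fun w => f w + g w) =
  (fun w => restrict_to A f w + restrict_to A g w).
Proof. by apply/funext => w; rewrite /restrict_to scalerDr. Qed.

Lemma restrict_toB (A : set T) f g w :
  restrict_to A f w - restrict_to A g w = restrict_to A (fun w => f w - g w) w.
Proof. by rewrite /restrict_to scalerBr. Qed.

Lemma restrict_toI (A B : set T) f :
  restrict_to A (restrict_to B f) = restrict_to (A `&` B) f.
Proof.
by apply/funext => w; rewrite /restrict_to scalerA indicI.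
Qed.

Lemma restrict_to_integrable (A : set T) f : measurable A -> borel_fun f ->
  integrable_element P f -> integrable_element P (restrict_to A f).
Proof.
move=> mA mf; move=> /(integrable_elementP P sepE mf) fi.
have mAf := restrict_to_borel mA mf; apply/(integrable_elementP P sepE mAf).
by apply: le_lt_trans fi; apply: le_integral_norm => // w; exact: restrict_to_norm.
Qed.

Lemma integrable_elementD f g : borel_fun f -> borel_fun g ->
  integrable_element P f -> integrable_element P g ->
  integrable_element P (fun w => f w + g w).
Proof.
move=> mf mg /(integrable_elementP P sepE mf) fi /(integrable_elementP P sepE mg) gi.
have mfg := borel_funD sepE mf mg; apply/(integrable_elementP P sepE mfg).
apply: le_lt_trans (le_integral_normD P sepE mf mg) _.
by rewrite lte_add_pinfty.
Qed.

Lemma cond_expD xi1 xi2 eta1 eta2 : borel_fun xi1 -> borel_fun xi2 ->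
  cond_exp P H xi1 eta1 -> cond_exp P H xi2 eta2 ->
  cond_exp P H (fun w => xi1 w + xi2 w) (fun w => eta1 w + eta2 w).
Proof.
move=> m1 m2 [r1 i1 b1] [r2 i2 b2].
have n1 := sub_borel_fun sH r1; have n2 := sub_borel_fun sH r2.
split.
- exact: (borel_funD sepE r1 r2).
- exact: integrable_elementD.
- move=> A HA; have [v1 x1 e1] := b1 A HA; have [v2 x2 e2] := b2 A HA.
  have mA := sub_measurable sH HA.
  by exists (v1 + v2); rewrite restrict_toD; apply: bochner_integralD => //;
    exact: restrict_to_borel.
Qed.

Lemma integrable_element0 : integrable_element P (fun=> 0 : E).
Proof.
apply/(integrable_elementP P sepE (borel_fun_cst 0)).
by under eq_integral do rewrite normr0; rewrite integral0.
Qed.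

Lemma bochner_integral0 : bochner_integral P (fun=> 0 : E) 0.
Proof.
have s0 := simple_cst (T := T) (0 : E).
have := bochner_integral_simple P s0; congr bochner_integral.
apply/eqP; rewrite -normr_le0 -lee_fin.
apply: le_trans (le_norm_simple_integral P s0) _.
by under eq_integral do rewrite normr0; rewrite integral0.
Qed.

Lemma restrict_to0 (A : set T) : restrict_to A (fun=> 0 : E) = fun=> 0.
Proof. by apply/funext => w; rewrite /restrict_to scaler0. Qed.

Lemma cond_exp0 : cond_exp P H (fun=> 0 : E) (fun=> 0).
Proof.
split; [exact: (borel_fun_cst (T := TH))|exact: integrable_element0|].
move=> A HA; exists 0; rewrite restrict_to0; exact: bochner_integral0.
Qed.

Lemma bochner_integral_scale_on (A : set T) (phi : T -> R) (x : E) (r : R) :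
  measurable A -> measurable_fun setT phi -> (forall w, 0 <= phi w) ->
  (\int[P]_(w in A) (phi w)%:E = r%:E)%E ->
  bochner_integral P (restrict_to A (fun w => phi w *: x)) (r *: x).
Proof.
move=> mA mphi phi0 phir.
have := @bochner_integral_scale _ E _ _ P sepE (fun w => \1_A w * phi w) x.
have iE : (\int[P]_w (\1_A w * phi w)%:E = r%:E)%E.
  rewrite -phir [RHS]integral_mkcond; apply: eq_integral => w _.
  by rewrite patchE indicE; case: ifP => _; rewrite ?mul1r ?mul0r.
rewrite iE /=; under [fun w => _ *: x]funext do rewrite -scalerA.
apply => //.
- by apply: measurable_funM => //; exact: measurable_indic.
- by move=> w; rewrite mulr_ge0.
- by rewrite ltry.
Qed.

(** The vector-valued conditional expectation of a multiple of an indicator is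
    the same multiple of a conditional probability. *)
Lemma cond_exp_indic (B : set T) (phi : T -> R) (x : E) : measurable B ->
  measurable_fun setT (phi : TH -> R) -> (forall w, 0 <= phi w) ->
  (forall A, H A -> (\int[P]_(w in A) (phi w)%:E = P (A `&` B))%E) ->
  cond_exp P H (fun w => \1_B w *: x) (fun w => phi w *: x).
Proof.
move=> mB mphi phi0 phiB; split.
- exact: (borel_fun_scale (T := TH)).
- have mphiT := sub_measurable_fun sH mphi.
  apply/(integrable_elementP P sepE (borel_fun_scale x mphiT)).
  under eq_integral => w _ do rewrite normrZ ger0_norm// mulrC EFinM.
  rewrite ge0_integralZl_EFin//; last 2 first.
    by move=> w _; rewrite lee_fin.
    exact/measurable_EFinP.
rewrite phiB ?setTI; last exact: sub_setT.
  by rewrite -ge0_fin_numE ?mule_ge0// fin_numM// fin_num_measure.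
- move=> A HA; have mA := sub_measurable sH HA.
  have PAB : P (A `&` B) \is a fin_num by apply: fin_num_measure; exact: measurableI.
  exists (fine (P (A `&` B)) *: x); apply: bochner_integral_scale_on => //.
  + by rewrite integral_indic// setIC fineK.
  + exact: (sub_measurable_fun sH).
  + by rewrite phiB// fineK.
Qed.

(** The L^1 bound uses that the level sets of [s] are disjoint: both sides are
    compared with the sum of [`|a|] times the probability of the level set
    of [a]. *)
Lemma cond_exp_simple s : simple_element s ->
  exists2 eta, cond_exp P H s eta &
    (\int[P]_w `|eta w|%:E <= \int[P]_w `|s w|%:E)%E.
Proof.
move=> ss; have [r [ur rP]] : exists r : seq E, uniq r /\ forall w, s w \in r.
  by apply: finite_range_seq; case: ss.
have mB a : measurable (s @^-1` [set a]) by exact: simple_fiber.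
have /choice[phi phiP] a := cond_prob P sH (mB a).
pose eta (r : seq E) w := \sum_(a <- r) phi a w *: a.
have cr (q : seq E) : cond_exp P H
    (fun w => \sum_(a <- q) \1_(s @^-1` [set a]) w *: a) (eta q).
  elim: q => [|a q IH].
    rewrite /eta; under eq_fun do rewrite big_nil.
    under [X in cond_exp _ _ _ X]eq_fun do rewrite big_nil.
    exact: cond_exp0.
  rewrite /eta; under eq_fun do rewrite big_cons.
  under [X in cond_exp _ _ _ X]eq_fun do rewrite big_cons.
  apply: cond_expD => //.
  - by apply: borel_fun_scale; exact: measurable_indic.
  - elim: q {IH} => [|b q IH].
      by under eq_fun do rewrite big_nil; exact: borel_fun_cst.
    under eq_fun do rewrite big_cons; apply: borel_funD => //.
    by apply: borel_fun_scale; exact: measurable_indic.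
  - by have [p1 p2 p3] := phiP a; exact: cond_exp_indic.
exists (eta r).
  rewrite (_ : s = fun w => \sum_(a <- r) \1_(s @^-1` [set a]) w *: a)//.
  apply/funext => w; rewrite (bigD1_seq (s w))//= indicE mem_set//= scale1r.
  rewrite big1 ?addr0// => a aw; rewrite indicE memNset ?scale0r// => /= sa.
  by rewrite sa eqxx in aw.
have mphi a : measurable_fun setT (fun w => (phi a w * `|a|)%:E).
  have [p1 _ _] := phiP a.
  by apply/measurable_EFinP; apply: measurable_funM => //; exact: (sub_measurable_fun sH).
have [mer _ _] := cr r.
apply: (@le_trans _ _ (\int[P]_w (\sum_(a <- r) (phi a w * `|a|)%:E))%E).
  apply: ge0_le_integral => //.
  - exact: (measurable_enorm sepE (sub_borel_fun sH mer)).
  - exact: emeasurable_sum.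
  - move=> w _; rewrite sumEFin lee_fin; apply: le_trans (ler_norm_sum _ _ _) _.
    apply: ler_sum => a _; rewrite normrZ ger0_norm//.
    by have [_ + _] := phiP a; apply.
rewrite ge0_integral_sum//; last first.
  by move=> a w _; rewrite lee_fin mulr_ge0//; have [_ + _] := phiP a; apply.
rewrite (integral_finite_range P ur rP mB (@normr_ge0 _ _)) -sumEFin.
apply: lee_sum => a _; have [p1 p2 p3] := phiP a.
under eq_integral do rewrite mulrC EFinM.
rewrite ge0_integralZl_EFin//; last 2 first.
  by move=> w _; rewrite lee_fin.
  by apply/measurable_EFinP; exact: (sub_measurable_fun sH).
rewrite p3; last exact: sub_setT.
by rewrite setTI EFinM fineK ?fin_num_measure// muleC.
Qed.

End CondExp.

(** * Existence of conditional expectations *)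

Section Existence.
Context {R : realType} {E : completeNormedModType R}.
Context {d : measure_display} {T : measurableType d}.
Variable P : probability T R.
Variable H : set (set T).
Hypothesis sepE : separable E.
Hypothesis sH : sub_sigma_algebra_of H.
Local Notation TH := (g_sigma_algebraType H).

Lemma sum_half_le2 n : \sum_(0 <= k < n) 2 ^- k <= 2 :> R.
Proof.
suff -> : \sum_(0 <= k < n) 2 ^- k = 2 - 2 * 2 ^- n :> R.
  by rewrite gerBl mulr_ge0// invr_ge0 exprn_ge0.
elim: n => [|n IH]; first by rewrite big_nil expr0 invr1 mulr1 subrr.
rewrite big_nat_recr//= IH (half_powS n); lra.
Qed.

Lemma summable_partial_sums_cvg (c : nat -> T -> E) (S : T -> \bar R) :
  (forall w n, (\sum_(0 <= k < n) `|c k w|%:E <= S w)%E) ->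
  forall w, (S w < +oo)%E -> cvgn (series (c^~ w)).
Proof.
move=> cS w Sw; apply: normed_cvg; apply: nondecreasing_is_cvgn.
  apply/nondecreasing_seqP => n; rewrite /normed_series_of /series/= big_nat_recr//= lerDl//.
have S0 : (0 <= S w)%E by have := cS w 0%N; rewrite big_nil.
exists (fine (S w)) => _ [n _ <-].
by rewrite -lee_fin fineK ?ge0_fin_numE// /normed_series_of /series/= -sumEFin; exact: cS.
Qed.

(** Write [f] as [s 0] plus the sum of the [t n = s n.+1 - s n], with the simple
    elements [s n] converging to [f] so fast that the norms of the [t n] in L^1
    are summable.  The conditional expectations [c n] of the [t n] then have
    summable norms in L^1, so their series converges absolutely almost surely and
    in L^1, and the defining identities pass to the limit. *)
Lemma cond_exp_exists (f : T -> E) : borel_fun f -> integrable_element P f ->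
  exists eta, cond_exp P H f eta.
Proof.
move=> mf fi; have fi' := (integrable_elementP P sepE mf).1 fi.
have /choice[s sP] n : exists s : T -> E, simple_element s /\
    (\int[P]_w `|(f w - s w)%R|%:E <= (2 ^- n.+1)%:E)%E.
  have [|s ss sf] := simple_approximation sepE mf fi' (eps := 2 ^- n.+1).
    exact: half_pow_gt0.
  by exists s.
have ss n : simple_element (s n) by have [] := sP n.
have sf n : (\int[P]_w `|(f w - s n w)%R|%:E <= (2 ^- n.+1)%:E)%E by have [] := sP n.
have ms n : borel_fun (s n) := simple_borel (ss n).
pose t n w := s n.+1 w - s n w.
have st n : simple_element (t n) by exact: (simple_comp2 (fun x y => x - y)).
have t2 n : (\int[P]_w `|t n w|%:E <= (2 ^- n)%:E)%E.
  apply: le_trans (le_integral_distD P sepE (ms n.+1) mf (ms n)) _.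
  under eq_integral do rewrite distrC.
  apply: (le_trans (leeD (sf n.+1) (sf n))); rewrite -EFinD lee_fin.
  have := @half_pow_gt0 R n.+2; rewrite (half_powS n) (half_powS n.+1); lra.
have /choice[c cP] n : exists c : T -> E, cond_exp P H (t n) c /\
    (\int[P]_w `|c w|%:E <= \int[P]_w `|t n w|%:E)%E.
  by have [c] := cond_exp_simple P sepE sH (st n); exists c.
have [b bP _] := cond_exp_simple P sepE sH (ss 0%N).
pose C n w := b w + series (c^~ w) n.
have CP n : cond_exp P H (s n) (C n).
  elim: n => [|n IH].
    rewrite (_ : C 0%N = b)//; apply/funext => w.
    by rewrite /C /series /= big_nil addr0.
  have -> : s n.+1 = fun w => s n w + t n w.
    by apply/funext => w; rewrite /t addrC subrK.
  have -> : C n.+1 = fun w => C n w + c n w.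
    by apply/funext => w; rewrite /C /series /= big_nat_recr//= addrA.
  apply: cond_expD => //; first exact: simple_borel.
  by have [] := cP n.
have mC n : random_element H (C n) by have [] := CP n.
have mCT n : borel_fun (C n) := sub_borel_fun sH (mC n).
have mc n : random_element H (c n) by have [[]] := cP n.
pose S w := (\sum_(0 <= k <oo) `|c k w|%:E)%E.
have cS w n : (\sum_(0 <= k < n) `|c k w|%:E <= S w)%E.
  by apply: nneseries_lim_ge => k _ _; rewrite lee_fin.
have S0 w : (0 <= S w)%E by have := cS w 0%N; rewrite big_nil.
have mS : measurable_fun setT (S : TH -> \bar R).
  apply: (@emeasurable_fun_cvg _ TH R setT
    (fun n w => \sum_(0 <= k < n) `|c k w|%:E)%E) => //.
    move=> n; apply: emeasurable_sum => k.
    exact: (measurable_enorm sepE (mc k)).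
  by move=> w _; apply: is_cvg_nneseries => k _ _; rewrite lee_fin.
have mST : measurable_fun setT S by exact: (sub_measurable_fun sH).
have SI : P.-integrable setT S.
  apply/integrableP; split => //.
  under eq_integral do rewrite gee0_abs//.
  rewrite integral_nneseries//; last first.
    by move=> n; exact: (measurable_enorm sepE (sub_borel_fun sH (mc n))).
  apply: (@le_lt_trans _ _ 2%:E); last exact: ltry.
  apply: lime_le.
    by apply: is_cvg_nneseries => n _ _; exact: integral_norm_ge0.
  apply: nearW => n; apply: (@le_trans _ _ (\sum_(0 <= k < n) (2 ^- k)%:E)%E).
    apply: lee_sum => k _; apply: le_trans (t2 k); by have [] := cP k.
  by rewrite sumEFin lee_fin sum_half_le2.
(* The limit is cut to the event W, which lies in H, so as to be H-measurable
   everywhere and not only almost surely. *)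
pose W := [set w | (S w < +oo)%E].
have HW : H W.
  have : measurable (W : set TH).
    rewrite (_ : W = S @^-1` (~` [set +oo%E])).
      rewrite -[X in measurable X]setTI; apply: mS => //.
      by apply: measurableC; exact: emeasurable_set1.
    by apply/seteqP; split => w /=; rewrite /W/= ltey => /eqP.
  by move/(measurable_subP sH).
have Ccvg w : W w -> cvgn (C ^~ w).
  move=> Ww; apply: is_cvgD; first exact: is_cvg_cst.
  exact: summable_partial_sums_cvg cS _ Ww.
pose eta w := lim (restrict_to W (C n) w @[n --> \oo]).
have etaC w : restrict_to W (C n) w @[n --> \oo] --> eta w.
  rewrite /eta; have [Ww|nW] := pselect (W w).
    have -> : (fun n => restrict_to W (C n) w) = C^~ w.
      by apply/funext => n; rewrite restrict_toE mem_set.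
    exact: Ccvg.
  have -> : (fun n => restrict_to W (C n) w) = (fun=> 0).
    by apply/funext => n; rewrite restrict_toE memNset.
  exact: is_cvg_cst.
have meta : random_element H eta.
  apply: (@borel_fun_lim _ _ _ TH (fun n => restrict_to W (C n))) => // n.
  exact: restrict_to_random_element.
have metaT := sub_borel_fun sH meta.
have etaW w : W w -> C n w @[n --> \oo] --> eta w.
  move=> Ww; have := etaC w.
  have -> // : (fun n => restrict_to W (C n) w) = C^~ w.
  by apply/funext => n; rewrite restrict_toE mem_set.
have CD n m w : (n <= m)%N -> ((`|C m w - C n w|)%:E <= S w)%E.
  move=> nm; apply: le_trans (cS w m).
  rewrite /C /series/= opprD addrACA subrr add0r.
  rewrite (@big_cat_nat _ _ _ n)//= addrAC subrr add0r.
  rewrite (@big_cat_nat _ _ _ n 0 m)//= -[leLHS]add0e; apply: leeD.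
    by apply: sume_ge0 => k _; rewrite lee_fin.
  by rewrite sumEFin lee_fin ler_norm_sum.
have etaD n w : W w -> ((`|eta w - C n w|)%:E <= S w)%E.
  move=> Ww; apply: (@cvge_le _ \oo _ _ (fun m => (`|C m w - C n w|)%:E)).
    by exists n => // m /= nm; exact: CD.
  apply: cvg_EFin; first exact: nearW.
  by apply: cvg_norm; apply: cvgB; [exact: etaW|exact: cvg_cst].
have aeW' : {ae P, forall w, W w}.
  have := integrable_ae measurableT SI; apply: filterS => w /(_ I).
  by rewrite ge0_fin_numE.
have [_ _ Ci] : [/\ P.-integrable setT (fun=> 0%E : \bar R),
    (\int[P]_w `|(`|(eta w - C n w)%R|%:E - 0)%E|)%E @[n --> \oo] --> 0%E &
    (\int[P]_w `|(eta w - C n w)%R|%:E)%E @[n --> \oo] --> (\int[P]_w (fun=> 0%E : \bar R) w)%E].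
  apply: (@dominated_convergence _ _ _ P setT measurableT
    (fun n w => `|(eta w - C n w)%R|%:E) (fun=> 0%E) S) => //.
  - by move=> n; exact: (measurable_enorm sepE (borel_funB sepE metaT (mCT n))).
  - move: aeW'; apply: filterS => w Ww _.
    apply: cvg_EFin; first exact: nearW.
    rewrite -(normr0 E) -(subrr (eta w)); apply: cvg_norm.
    by apply: cvgB; [exact: cvg_cst|exact: etaW].
  - by move: aeW'; apply: filterS => w Ww n _; rewrite gee0_abs ?lee_fin//; exact: etaD.
rewrite integral0 in Ci.
have etai : integrable_element P eta.
  apply/(integrable_elementP P sepE metaT).
  have [N /(_ N (leqnn N)) CN] := (cvge0P (fun n => integral_norm_ge0 P _)).1 Ci _ ltr01.
  have [_ /(integrable_elementP P sepE (mCT N)) CiN _] := CP N.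
  have := le_integral_normD P sepE (borel_funB sepE metaT (mCT N)) (mCT N).
  under eq_integral do rewrite subrK.
  move=> /le_lt_trans; apply; apply: lte_add_pinfty => //.
  by apply: le_lt_trans CN _; exact: ltry.
exists eta; split => // A HA; have mA := sub_measurable sH HA.
have /choice[v vP] n : exists v, bochner_integral P (restrict_to A (s n)) v /\
    bochner_integral P (restrict_to A (C n)) v.
  by have [_ _ /(_ _ HA)[v v1 v2]] := CP n; exists v.
have mrs n : borel_fun (restrict_to A (s n)) by exact: restrict_to_borel.
have mrC n : borel_fun (restrict_to A (C n)) by exact: restrict_to_borel.
have rdist (g h : T -> E) : borel_fun g -> borel_fun h ->
    (\int[P]_w `|(restrict_to A g w - restrict_to A h w)%R|%:E <=
     \int[P]_w `|(g w - h w)%R|%:E)%E.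
  move=> mg mh; under eq_integral do rewrite restrict_toB.
  apply: le_integral_norm => //; last by move=> w; exact: restrict_to_norm.
    by apply: restrict_to_borel => //; exact: borel_funB.
  exact: borel_funB.
have [vl vvl _] : exists2 l, v @ \oo --> l & forall n, `|l - v n| <= 2 * 2 ^- n.
  apply: geometric_cvg => n; rewrite -lee_fin.
  have [v1 _] := vP n.+1; have [v2 _] := vP n.
  apply: le_trans (bochner_integral_dist sepE (mrs _) (mrs _) v1 v2) _.
  exact: le_trans (rdist _ _ (ms _) (ms _)) (t2 n).
exists vl.
- apply: (bochner_integral_lim sepE (h_ := fun n => restrict_to A (s n)) (v_ := v)) => //.
  + exact: restrict_to_borel.
  + by move=> n; have [] := vP n.
  + apply/cvge0P => [n|e e0]; first exact: integral_norm_ge0.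
    have [N HN] := half_small e0; exists N => n Nn.
    apply: le_trans (rdist _ _ mf (ms n)) _; apply: le_trans (sf n) _.
    by rewrite lee_fin ltW// HN// leqW.
- apply: (bochner_integral_lim sepE (h_ := fun n => restrict_to A (C n)) (v_ := v)) => //.
  + exact: restrict_to_borel.
  + by move=> n; have [] := vP n.
  + apply/cvge0P => [n|e e0]; first exact: integral_norm_ge0.
    have [N HN] := (cvge0P (fun n => integral_norm_ge0 P _)).1 Ci _ e0.
    by exists N => n /HN; apply: le_trans; exact: rdist.
Qed.

End Existence.

(** * Almost sure comparison of random sets *)

Section AlmostSure.
Context {R : realType} {E : completeNormedModType R}.
Context {d : measure_display} {T : measurableType d}.
Variable P : probability T R.
Variable H : set (set T).
Hypothesis sepE : separable E.
Hypothesis sH : sub_sigma_algebra_of H.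
Local Notation TH := (g_sigma_algebraType H).
Implicit Types (X Y Z : T -> set E) (xi eta : T -> E) (S : set (T -> E)).

Lemma measurable_dist (f g : T -> E) (e : R) : borel_fun f -> borel_fun g ->
  measurable [set w | e < `|f w - g w|].
Proof.
move=> mf mg.
have := measurable_norm sepE (borel_funB sepE mf mg).
move=> /(_ measurableT `]e, +oo[%classic (measurable_itv _)); rewrite setTI.
by congr measurable; apply/seteqP; split => w /=; rewrite in_itv/= andbT.
Qed.

(** Markov's inequality: if the L^1 distance is less than [e * e], the distance
    exceeds [e] with probability less than [e]. *)
Lemma cl1_sub_cl0 S S' : S `<=` S' -> (forall eta, S eta -> random_element H eta) ->
  cl1 P H S `<=` cl0 P H S'.
Proof.
move=> SS' mS xi [mxi _ xiS]; split => // e e0.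
have [eta Seta xieta] := xiS (e * e) (mulr_gt0 e0 e0).
exists eta; first exact: SS'.
have mf := sub_borel_fun sH mxi; have mg := sub_borel_fun sH (mS _ Seta).
set D := [set w | _].
have mD : measurable D by exact: measurable_dist.
rewrite -(@lte_pmul2l _ e%:E) ?lte_fin//.
rewrite -EFinM; apply: le_lt_trans xieta.
rewrite -[P D]/((P : set T -> \bar R) D) -[X in P X]setIT -integral_indic//.
rewrite -ge0_integralZl_EFin//; last 2 first.
- by apply/measurable_EFinP; exact: measurable_indic.
- exact: ltW.
apply: ge0_le_integral => //.
- by move=> w _; rewrite mule_ge0// lee_fin ltW.
- by apply: measurable_funeM; apply/measurable_EFinP; exact: measurable_indic.
- exact: (measurable_enorm sepE (borel_funB sepE mf mg)).
- move=> w _; rewrite indicE; case: (boolP (w \in D)) => [/set_mem Dw|_].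
    by rewrite mule1 lee_fin ltW.
  by rewrite mule0 lee_fin.
Qed.

(** Take [eta n] within [2 ^- n] of [xi] outside an event of probability less
    than [2 ^- n].  Almost surely infinitely many of these events fail, so that
    [xi w] is a limit point of the [eta n w]. *)
Lemma cl0_ae_closed Y S xi : {ae P, forall w, closed (Y w)} ->
  (forall eta, S eta -> random_element H eta /\ {ae P, forall w, Y w (eta w)}) ->
  cl0 P H S xi -> {ae P, forall w, Y w (xi w)}.
Proof.
move=> cY SY [mxi xiS].
have e0 n : 0 < 2 ^- n :> R by exact: half_pow_gt0.
have /choice[eta etaP] n : exists eta, S eta /\
    (P [set w | (2 ^- n < `|xi w - eta w|)%R] < (2 ^- n)%:E)%E.
  by have [eta] := xiS _ (e0 n); exists eta.
have mD n : measurable [set w | (2 ^- n < `|xi w - eta n w|)%R].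
  apply: measurable_dist; first exact: (sub_borel_fun sH).
  by have [/SY[+ _] _] := etaP n; exact: (sub_borel_fun sH).
(* N m lies in events of arbitrarily small probability. *)
pose N m := \bigcap_(n in [set n | (m <= n)%N]) [set w | (2 ^- n < `|xi w - eta n w|)%R].
have N0 m : P.-negligible (N m).
  apply: contrapT => /not_negligible_outer_gt[r r0 bigr].
  have [k hk] := half_small r0.
  have [_ Pn] := etaP (maxn m k).
  have : (r%:E < P [set w | (2 ^- (maxn m k) < `|xi w - eta (maxn m k) w|)%R])%E.
    by apply: bigr => // w Nw; apply: Nw => /=; exact: leq_maxl.
  move=> /lt_trans /(_ Pn); rewrite lte_fin ltNge => /negP; apply; apply/ltW/hk.
  exact: leq_maxr.
have aeN : {ae P, forall w, forall m, ~ N m w}.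
  rewrite /almost_everywhere; have := negligible_bigcup N0; apply: negligibleS.
  by move=> w /= /existsNP[m /contrapT Nm]; exists m.
have aeeta : {ae P, forall w, forall n, Y w (eta n w)}.
  by apply: ae_foralln => n; have [/SY[]] := etaP n.
apply: filterS3 cY aeN aeeta => w cYw Nw Yeta.
rewrite ((closure_id _).1 cYw) => B /nbhs_ballP[r /= r0 rB].
have [k hk] := half_small r0.
have [n kn nN] : exists2 n, (k <= n)%N & `|xi w - eta n w| <= 2 ^- n.
  apply: contrapT => /forall2NP no; apply: (Nw k) => n /= kn.
  by have [//|/negP] := no n; rewrite -ltNge.
exists (eta n w); split => //; apply: rB; rewrite -ball_normE /ball_/=.
exact: le_lt_trans nN (hk _ kn).
Qed.

(** The selection [xi0] is there to complete a selection that is only defined on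
    an event. *)
Lemma ae_subset_of_selections Y Z xi0 : random_set H Y -> random_set H Z ->
  L1sel P Y H xi0 ->
  (forall xi, L1sel P Y H xi -> {ae P, forall w, Z w (xi w)}) ->
  {ae P, forall w, Y w `<=` Z w}.
Proof.
move=> mY mZ [[mx0 Yx0] ix0] YZ; apply: contrapT => notae.
pose G : set (TH * borelType E) := [set z | Y z.1 z.2] `&` ~` [set z | Z z.1 z.2].
have mG : measurable G by apply: measurableI => //; exact: measurableC.
have notneg : ~ (trim P sH).-negligible [set w | exists x, G (w, x)].
  move=> [B [mB PB GB]]; apply: notae; exists B; split.
  - exact/(sub_measurable sH)/(measurable_subP sH).
  - by rewrite -(trimE P sH).
  - move=> w /= /existsNP[x /not_implyP[Yx Zx]]; apply: GB.
    by exists x; split.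
have [A [f [mA PA mf fG]]] : exists A (f : T -> E), [/\ measurable (A : set TH),
    (0 < trim P sH A)%E, borel_fun (f : TH -> E) & forall w, A w -> G (w, f w)].
  exact: measurable_selection sepE mG notneg.
(* Cutting to bounded values makes the selection integrable. *)
pose An n : set T := A `&` f @^-1` (ball (0 : E) n%:R).
have mAn n : measurable (An n : set TH).
  by apply: measurableI => //; apply: (borel_fun_open mf); exact: ball_open.
have HAn n : H (An n) by apply/(measurable_subP sH).
have HAC n : H (~` An n) by exact: sub_setC.
have mfT : borel_fun (f : T -> E) := sub_borel_fun sH mf.
have mx0T := sub_borel_fun sH mx0.
have negAn n : P.-negligible (An n).
  pose xi w := restrict_to (An n) f w + restrict_to (~` An n) xi0 w.
  have mfn : borel_fun (restrict_to (An n) f : T -> E).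
    apply: restrict_to_borel => //; exact: (sub_measurable sH).
  have mx0n : borel_fun (restrict_to (~` An n) xi0 : T -> E).
    apply: restrict_to_borel => //; exact: (sub_measurable sH).
  have mxi : random_element H xi.
    apply: (borel_funD (T := TH) sepE); exact: restrict_to_random_element.
  have xiY : L1sel P Y H xi.
    split; first split => //.
    - apply: filterS Yx0 => w Yx0; rewrite /xi !restrict_toE in_setC.
      case: ifPn => [/set_mem[/fG[Yf _] _]|_] /=; first by rewrite addr0.
      by rewrite add0r.
    - apply: integrable_elementD => //.
      + apply/(integrable_elementP P sepE mfn).
        apply: (@le_lt_trans _ _ (\int[P]_w (n%:R)%:E)%E).
          apply: ge0_le_integral => //.
          * exact: (measurable_enorm sepE mfn).
          * move=> w _; rewrite restrict_toE lee_fin; case: ifPn => [/set_mem[_]|_].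
              by rewrite /= -ball_normE /ball_/= sub0r normrN => /ltW.
            by rewrite normr0.
        by rewrite integral_cst// -[X in (_ * X)%E]/(P setT) probability_setT mule1 ltry.
      + apply: restrict_to_integrable => //; exact: (sub_measurable sH).
  have := YZ _ xiY; apply: negligibleS => w Anw /=; rewrite /xi !restrict_toE.
  rewrite mem_set// memNset; last by move=> /(_ Anw).
  by rewrite addr0 => Zf; have [/fG[_ nZ] _] := Anw; apply: nZ.
have : P.-negligible A.
  have := negligible_bigcup negAn; apply: negligibleS => w Aw.
  have [n fn] : exists n : nat, `|f w| < n%:R.
    by exists (Num.truncn `|f w|).+1; exact: truncnS_gt.
  by exists n => //; split => //=; rewrite -ball_normE /ball_/= sub0r normrN.
move=> /negligibleP; have HA : H A by apply/(measurable_subP sH).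
move=> /(_ (sub_measurable sH HA)) PA0.
by move: PA; rewrite trimE -[P A]/((P : set T -> \bar R) A) PA0 ltxx.
Qed.

Lemma sub_cl1 S : (forall eta, S eta -> random_element H eta /\ integrable_element P eta) ->
  S `<=` cl1 P H S.
Proof.
move=> SP eta Seta; have [mx ix] := SP _ Seta; split => // e e0.
exists eta => //; under eq_integral do rewrite subrr normr0.
by rewrite integral0 lte_fin.
Qed.

Lemma cond_exp_restrict (B : set T) xi eta : H B ->
  cond_exp P H xi eta -> cond_exp P H (restrict_to B xi) (restrict_to B eta).
Proof.
move=> HB [mx ix bx]; have mB := sub_measurable sH HB; split.
- exact: restrict_to_random_element.
- apply: restrict_to_integrable => //; exact: (sub_borel_fun sH).
- move=> A HA; rewrite !restrict_toI; apply: bx.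
  by apply/(measurable_subP sH)/measurableI; apply/(measurable_subP sH).
Qed.

(** The partition has the whole space as its only non-empty block. *)
Lemma cond_exp_gen (xi eta : T -> E) : integrable_element P xi ->
  cond_exp P H xi eta -> gen_cond_exp P H xi eta.
Proof.
move=> ix cx; split; first by case: cx.
have H0 : H set0 by have [[]] := sH.
have HT := sub_setT sH.
have r0 (f : T -> E) : restrict_to set0 f = fun=> 0.
  by apply/funext => w; rewrite restrict_toE memNset.
have rT (f : T -> E) : restrict_to setT f = f.
  by apply/funext => w; rewrite restrict_toE mem_set.
exists (fun i => if i is 0%N then setT else set0).
exists (fun i => if i is 0%N then eta else fun=> 0).
split.
- split.
  + by case.
  + by apply/trivIsetP => -[|i] [|j] //= _ _ _; rewrite ?setI0 ?set0I.
  + by apply/seteqP; split => // w _; exists 0%N.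
  + by case=> [|i]; rewrite ?rT ?r0//; exact: integrable_element0.
- by case=> [|i]; rewrite ?rT ?r0//; exact: cond_exp0.
- apply: aeW => w; apply/cvgrPdist_le => e e0; exists 1%N => // n /= n1.
  rewrite big_ltn// rT big_nat_cond big1 ?addr0 ?subrr ?normr0 ?ltW// => i.
  by rewrite andbT => /andP[]; case: i => // i _ _; rewrite restrict_toE memNset.
Qed.

(** The glued elements [xi'] are integrable even if [xi] is not, because [xi] is
    integrable on each block. *)
Lemma gen_cond_exp_selection X Y xi eta :
  integrable_random_set P X -> cond_exp_set P H X Y ->
  L1Hsel P X H xi -> gen_cond_exp P H xi eta ->
  {ae P, forall w, Y w (eta w)}.
Proof.
move=> [chi [[/random_element_borel mchi Xchi] ichi]] [_ YE].
move=> [[/random_element_borel mxi Xxi] _] [_ [A [zeta [[HA tA UA iA] zetaA sumA]]]].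
have [c cchi] := cond_exp_exists sepE sH mchi ichi.
pose psi i w := restrict_to (A i) (zeta i) w + restrict_to (~` A i) c w.
have HAC i : H (~` A i) by exact: (sub_setC sH).
have mA i := sub_measurable sH (HA i).
have psiY i : L1sel P Y H (psi i).
  pose xi' w := restrict_to (A i) xi w + restrict_to (~` A i) chi w.
  have cpsi : cond_exp P H xi' (psi i).
    apply: (cond_expD sepE sH).
    - exact: restrict_to_borel.
    - by apply: restrict_to_borel => //; exact: measurableC.
    - by have := cond_exp_restrict (HA i) (zetaA i); rewrite restrict_toI setIid.
    - exact: cond_exp_restrict.
  rewrite YE; apply: sub_cl1; first by move=> e [? _ []].
  exists xi' => //; split.
    split.
      apply/random_element_borel; apply: (borel_funD sepE).
        exact: restrict_to_borel.
      by apply: restrict_to_borel => //; exact: measurableC.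
    apply: filterS2 Xchi Xxi => w Xchi Xxi; rewrite /xi' !restrict_toE in_setC.
    by case: ifPn => _ /=; rewrite ?addr0 ?add0r.
  apply: integrable_elementD => //.
  - exact: restrict_to_borel.
  - by apply: restrict_to_borel => //; exact: measurableC.
  - by apply: restrict_to_integrable => //; exact: measurableC.
have aepsi : {ae P, forall w, forall i, Y w (psi i w)}.
  by apply: ae_foralln => i; have [[]] := psiY i.
apply: filterS2 aepsi sumA => w Ypsi sumw.
have [i _ Ai] : (\bigcup_i A i) w by rewrite UA.
suff -> : eta w = psi i w by exact: Ypsi.
have psiE : psi i w = restrict_to (A i) (zeta i) w.
  by rewrite /psi [X in _ + X]restrict_toE memNset ?addr0// => /(_ Ai).
rewrite psiE; apply: (cvg_unique _ sumw) => //.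
apply/cvgrPdist_le => e e0; exists i.+1 => // n /= ni.
rewrite (bigD1_seq i)/= ?iota_uniq ?mem_index_iota// big1 ?addr0 ?subrr ?normr0 ?ltW// => j ji.
rewrite restrict_toE memNset// => Aj; move/eqP : ji; apply.
by apply: (tA j i) => //; exists w.
Qed.

End AlmostSure.

Theorem lemma6p4 (R : realType) (E : completeNormedModType R)
    (d : measure_display) (T : measurableType d) (P : probability T R)
    (H : set (set T)) (X Y Z : T -> set E) :
  separable E ->
  measure_is_complete P ->
  sub_sigma_algebra_of H ->
  random_closed_set P d.-measurable X ->
  integrable_random_set P X ->
  cond_exp_set P H X Y ->
  gen_cond_exp_set P H X Z ->
  {ae P, forall w, Y w = Z w}.
Proof.
move=> sepE _ sH _ iX cY [[mZ cZ] ZE]; have [[mY clY] YE] := cY.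
have YZ xi : L1sel P Y H xi -> L0sel P Z H xi.
  rewrite YE ZE; apply: (cl1_sub_cl0 sepE sH) => [eta [f [fX fi] feta]|eta [f _ []]]//.
  have mf : borel_fun f by apply/random_element_borel; case: fX.
  exists f; last exact: (cond_exp_gen sepE sH).
  split => //.
  by have [_ [A [zeta [Ap _ _]]]] := cond_exp_gen sepE sH fi feta; exists A.
have [xi0 xi0Y] : L1sel P Y H !=set0.
  have [chi [Xchi ichi]] := iX.
  have mchi : borel_fun chi by apply/random_element_borel; case: Xchi.
  have [c cchi] := cond_exp_exists sepE sH mchi ichi.
  by exists c; rewrite YE; apply: sub_cl1; [move=> e [? _ []]|exists chi].
have ZY xi : L1sel P Z H xi -> {ae P, forall w, Y w (xi w)}.
  move=> [+ _]; rewrite ZE; apply: (cl0_ae_closed sepE sH clY).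
  move=> eta [f fX fe]; split; first by case: fe.
  exact: (gen_cond_exp_selection sepE sH iX cY fX fe).
have Y_sub_Z := ae_subset_of_selections sepE sH mY mZ xi0Y (fun xi h => (YZ xi h).2).
have xi0Z : L1sel P Z H xi0 by split; [exact: YZ|case: xi0Y].
have Z_sub_Y := ae_subset_of_selections sepE sH mZ mY xi0Z ZY.
by apply: filterS2 Y_sub_Z Z_sub_Y => w; rewrite eqEsubset.
Qed.
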